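(* Let $n\in\omega=\{0,1,2,\dots\}$. Let $\mathbb{J}_n=\langle J_n;\mathcal R_{(n)},\mathscr T\rangle$ be the alter ego of the algebra $\mathbf J_n$, where $\mathscr T$ is the discrete topology and $\mathcal R_{(n)}$ is the set of compatible binary relations on $\mathbf J_n$ given by $$\mathcal R_{(0)}=\{S_{0,0}\},\quad \mathcal R_{(1)}=\{S_{1,0},S_{1,1}\},\quad \mathcal R_{(2)}=\{S_{2,0},S_{2,1},S_{2,2}\},\quad \mathcal R_{(3)}=\{S_{3,0},S_{3,1},S_{3,2},S_{3,3},R_{3,0,2}\},$$ and, in general, for $n\geqslant 3$, $$\mathcal R_{(n)}=\{S_{n,i}\mid 0\leqslant i\leqslant n\}\cup\{R_{n,i,j}\mid i,j\in\{0,\dots,n-1\}\text{ with } i<j-1\}.$$ Then: (1) $\mathbb J_n$ yields an optimal duality on the quasivariety $\mathcal J_n=\mathsf{ISP}(\mathbf J_n)$. (2) $\mathbb J_0$ and $\mathbb J_1$ yield strong, and therefore full, dualities on $\mathcal J_0$ and $\mathcal J_1$, respectively. (3) For all $n\geqslant 2$, the duality on $\mathcal J_n$ can be upgraded to a strong, and therefore full, duality by adding all compatible $n$-ary partial operations on $\mathbf J_n$ to the structure of the alter ego $\mathbb J_n$. (4) $|\mathcal R_{(0)}|=1$ and $|\mathcal R_{(n)}|=\tfrac12(n^2-n+4)$ for all $n\geqslant 1$.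
   Context: **The algebra $\mathbf J_n$.** $J_n=\{\top,\bot,f_0,\dots,f_n,t_0,\dots,t_n\}$ ($2n+4$ distinct elements). Knowledge order $\leqslant_k$: $\bot$ is least, $\top$ is greatest, $f_n<_k\cdots<_k f_1<_k f_0$, $t_n<_k\cdots<_k t_1<_k t_0$, and each $f_i$ is incomparable to each $t_j$. Truth order $\leqslant_t$: $f_0<_t f_1<_t\cdots<_t f_n<_t x<_t t_n<_t\cdots<_t t_1<_t t_0$ for both $x\in\{\top,\bot\}$, with $\top,\bot$ incomparable. Both are lattice orders; $\otimes,\oplus$ are meet and join for $\leqslant_k$, and $\wedge,\vee$ are meet and join for $\leqslant_t$. Negation: $\neg\top=\top$, $\neg\bot=\bot$, $\neg f_m=t_m$, $\neg t_m=f_m$. $\mathbf J_n=\langle J_n;\otimes,\oplus,\wedge,\vee,\neg,\top,f_0,\dots,f_n,t_0,\dots,t_n,\bot\rangle$, with every element named by a constant. Write $F_n=\{f_0,\dots,f_n\}$, $T_n=\{t_0,\dots,t_n\}$. **The relations.** $S_{n,n}=(J_n\times\{\top\})\cup(\{\bot\}\times J_n)\cup F_n^2\cup T_n^2$. For $n\geqslant1$ and $0\leqslant i\leqslant n-1$, $S_{n,i}=\{(\top,\top),(\bot,\bot)\}\cup\big(F_n^2\setminus(\{f_0,\dots,f_i\}\times\{f_{i+1},\dots,f_n\})\big)\cup\big(T_n^2\setminus(\{t_0,\dots,t_i\}\times\{t_{i+1},\dots,t_n\})\big)$. For $n\geqslant 2$ and $i,j\in\{0,\dots,n-1\}$, $R_{n,i,j}=S_{n,i}\cup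 S_{n,j}$. **Natural dualities.** Let $\mathbf M$ be a finite algebra and $\mathcal A=\mathsf{ISP}(\mathbf M)$ the class of isomorphic copies of subalgebras of (possibly empty-indexed) powers of $\mathbf M$. A finitary relation on $M$ is *compatible* with $\mathbf M$ if it is a non-empty subuniverse of a finite power of $\mathbf M$; a (partial) operation on $M$ is compatible if its graph is a non-empty subuniverse of a finite power of $\mathbf M$ (equivalently, it is a homomorphism into $\mathbf M$ from a subalgebra of a finite power of $\mathbf M$). An *alter ego* of $\mathbf M$ is a structure $\mathbb M=\langle M;\mathcal G,\mathcal H,\mathcal R,\mathscr T\rangle$, where $\mathcal G,\mathcal H,\mathcal R$ are sets of compatible operations, partial operations and relations and $\mathscr T$ is the discrete topology (empty sets are omitted from the notation). Let $\mathcal X=\mathsf{IS_cP^+}(\mathbb M)$ be the category of isomorphic copies of topologically closed substructures (possibly empty) of powers $\mathbb M^I$, $I\neq\varnothing$, with structure defined pointwise; the morphisms are the continuous maps preserving the operations, partial operations and relations. For $\mathbf A\in\mathcal A$, $\mathrm D(\mathbf A)=\mathcal A(\mathbf A,\mathbf M)$ is the set of homomorphisms as a closed substructure of $\mathbb M^A$; for $\mathbb X\in\mathcal X$, $\mathrm E(\mathbb X)=\mathcal X(\mathbb X,\mathbb M)$ is the set of morphisms as a subalgebra of $\mathbf M^X$. The evaluation maps are $e_{\mathbf A}:\mathbf A\to\mathrm{ED}(\mathbf A)$, $e_{\mathbf A}(a)(x)=x(a)$, and $\varepsilon_{\mathbb X}:\mathbb X\to\mathrm{DE}(\mathbb X)$,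 $\varepsilon_{\mathbb X}(x)(\alpha)=\alpha(x)$; they are always embeddings. $\mathbb M$ *yields a duality* on $\mathcal A$ if $e_{\mathbf A}$ is an isomorphism for all $\mathbf A\in\mathcal A$; a *full duality* if moreover $\varepsilon_{\mathbb X}$ is an isomorphism for all $\mathbb X\in\mathcal X$; a *strong duality* if it yields a full duality and $\mathbb M$ is injective in $\mathcal X$ (morphisms into $\mathbb M$ extend along embeddings in $\mathcal X$). A duality is *optimal* if no relation or (partial) operation can be removed from the structure of the alter ego without destroying the duality. *)

(* Defs.v *)
From HB Require Import structures.
From mathcomp Require Import all_boot all_order.
From mathcomp Require Import zify.
From mathcomp Require Import all_classical.
From mathcomp Require Import topology_structure discrete_topology.
From mathcomp Require Import initial_topology.
From mathcomp Require Import subtype_topology function_spaces.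

Set Implicit Arguments.
Unset Strict Implicit.
Unset Printing Implicit Defensive.

Import Order.TTheory.
Local Open Scope classical_set_scope.

Record signature := Signature {
  symbol :> Type;
  arity : symbol -> nat
}.

Record algebra (Sg : signature) := Algebra {
  carrier :> Type;
  op : forall f : Sg, ('I_(arity f) -> carrier) -> carrier
}.

Definition hom (Sg : signature) (A B : algebra Sg) (h : A -> B) : Prop :=
  forall (f : Sg) (x : 'I_(arity f) -> A), h (op x) = op (h \o x).

Definition alg_isomorphism (Sg : signature) (A B : algebra Sg) (h : A -> B) :
    Prop :=
  hom h /\ bijective h.

Definition alg_power (Sg : signature) (A : algebra Sg) (I : Type) :
    algebra Sg :=
  @Algebra Sg (I -> A) (fun f x i => op (fun k => x k i)).

Definition subuniverse (Sg : signature) (A : algebra Sg) (B : set A) : Prop :=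
  forall (f : Sg) (x : 'I_(arity f) -> A), (forall k, B (x k)) -> B (op x).

Definition subalgebra (Sg : signature) (A : algebra Sg) (B : set A)
    (hB : subuniverse B) : algebra Sg :=
  @Algebra Sg B (fun f x =>
    SigSub (mem_set (hB f (fun k => val (x k)) (fun k => set_valP (x k))))).

(* [I] may be empty, so that one-element algebras belong to the class. *)
Definition ISP (Sg : signature) (M A : algebra Sg) : Prop :=
  exists (I : Type) (B : set (alg_power M I)) (hB : subuniverse B)
    (h : A -> subalgebra hB), alg_isomorphism h.

Record fin_algebra (Sg : signature) := FinAlgebra {
  fin_carrier : finType;
  fin_op : forall f : Sg, ('I_(arity f) -> fin_carrier) -> fin_carrier
}.

Coercion algebra_of_fin (Sg : signature) (M : fin_algebra Sg) : algebra Sg :=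
  Algebra (@fin_op Sg M).

Record operation (M : Type) := Operation {
  op_arity : nat;
  op_val :> ('I_op_arity -> M) -> M
}.

Record partial_operation (M : Type) := PartialOperation {
  pop_arity : nat;
  pop_val :> ('I_pop_arity -> M) -> option M
}.

Record relation (M : Type) := Relation {
  rel_arity : nat;
  rel_val : set ('I_rel_arity -> M)
}.

Arguments rel_val {M} r _.

(* The last coordinate of a tuple of the graph is the value. *)
Definition graph (M : Type) (k : nat) (h : ('I_k -> M) -> option M) :
    set ('I_k.+1 -> M) :=
  [set x : 'I_k.+1 -> M | h (x \o lift ord_max) = Some (x ord_max)].

Section Compatible.
Variables (Sg : signature) (M : algebra Sg).

Definition compatible_set (k : nat) (r : set ('I_k -> M)) : Prop :=
  r !=set0 /\ @subuniverse Sg (alg_power M 'I_k) r.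

Definition compatible_rel (r : relation M) : Prop := compatible_set (rel_val r).

Definition compatible_pop (h : partial_operation M) : Prop :=
  compatible_set (graph h).

Definition compatible_op (g : operation M) : Prop :=
  compatible_set (graph (fun x => Some (g x))).

End Compatible.

(* The topology is always the discrete one, see [ego_space]. *)
Record alter_ego (Sg : signature) (M : fin_algebra Sg) := AlterEgo {
  ego_ops : set (operation M);
  ego_pops : set (partial_operation M);
  ego_rels : set (relation M);
  ego_opsP : ego_ops `<=` @compatible_op Sg M;
  ego_popsP : ego_pops `<=` @compatible_pop Sg M;
  ego_relsP : ego_rels `<=` @compatible_rel Sg M
}.

Definition ego_space (Sg : signature) (M : fin_algebra Sg) : topologicalType :=
  discrete_topology (fin_carrier M).

Section Structures.
Variables (Sg : signature) (M : fin_algebra Sg) (E : alter_ego M).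

Record structure := Structure {
  space :> topologicalType;
  sop : forall g : ego_ops E, ('I_(op_arity (val g)) -> space) -> space;
  spop : forall h : ego_pops E,
    ('I_(pop_arity (val h)) -> space) -> option space;
  srel : forall r : ego_rels E, set ('I_(rel_arity (val r)) -> space)
}.

Definition morphism (X Y : structure) (phi : X -> Y) : Prop :=
  [/\ continuous phi,
      forall (g : ego_ops E) (x : 'I_(op_arity (val g)) -> X),
        phi (sop x) = sop (phi \o x),
      forall (h : ego_pops E) (x : 'I_(pop_arity (val h)) -> X) (y : X),
        spop x = Some y -> spop (phi \o x) = Some (phi y) &
      forall (r : ego_rels E) (x : 'I_(rel_arity (val r)) -> X),
        srel x -> srel (phi \o x)].

Definition isomorphism (X Y : structure) (phi : X -> Y) : Prop :=
  morphism phi /\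
  exists psi : Y -> X, [/\ morphism psi, cancel phi psi & cancel psi phi].

Definition ego_structure : structure :=
  @Structure (ego_space M)
    (fun g x => val g x) (fun h x => val h x) (fun r x => rel_val (val r) x).

(* The pointwise partial operation is defined exactly where all its
   coordinates are. *)
Definition power_pop (I : Type) (h : partial_operation M)
    (x : 'I_(pop_arity h) -> I -> M) : option (I -> M) :=
  if pselect (forall i, exists y, h (fun k => x k i) = Some y) is left d
  then Some (fun i => projT1 (cid (d i)))
  else None.

Definition power_structure (I : Type) : structure :=
  @Structure {ptws I -> ego_space M}
    (fun g x i => val g (fun k => x k i))
    (fun h x => power_pop x)
    (fun r x => forall i, rel_val (val r) (fun k => x k i)).

Definition substructure_closed (X : structure) (S : set X) : Prop :=
  (forall (g : ego_ops E) (x : 'I_(op_arity (val g)) -> X),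
      (forall k, S (x k)) -> S (sop x)) /\
  (forall (h : ego_pops E) (x : 'I_(pop_arity (val h)) -> X) (y : X),
      (forall k, S (x k)) -> spop x = Some y -> S y).

(* [insub] never fails here, as S is closed under the partial operations. *)
Definition substructure (X : structure) (S : set X)
    (hS : substructure_closed S) : structure :=
  @Structure (set_type S)
    (fun g x => SigSub (mem_set
       (hS.1 g (fun k => val (x k)) (fun k => set_valP (x k)))))
    (fun h x => obind insub (spop (fun k => val (x k))))
    (fun r x => srel (fun k => val (x k))).

Definition IScP (X : structure) : Prop :=
  exists (I : Type) (S : set (power_structure I))
    (hS : substructure_closed S) (phi : X -> substructure hS),
    [/\ inhabited I, closed S & isomorphism phi].

Definition embedding (X Y : structure) (phi : X -> Y) : Prop :=
  exists (S : set Y) (hS : substructure_closed S) (psi : X -> substructure hS),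
    [/\ closed S, isomorphism psi & forall x, phi x = val (psi x)].

Lemma power_popP (I : Type) (h : partial_operation M)
    (x : 'I_(pop_arity h) -> I -> M) (y : I -> M) :
  power_pop x = Some y <-> forall i, h (fun k => x k i) = Some (y i).
Proof.
rewrite /power_pop; case: pselect => [d|nd]; split=> //.
- by case=> <- i; case: cid.
- move=> hy; congr Some; apply: funext => i.
  by case: cid => z /= hz; move: (hy i); rewrite hz => -[].
- by move=> hy; case: nd => i; exists (y i).
Qed.

Lemma compatible_graphP (k : nat) (h : ('I_k -> M) -> option M) (f : Sg)
    (x : 'I_(arity f) -> 'I_k -> M) (y : 'I_(arity f) -> M) :
  @compatible_set Sg M k.+1 (graph h) ->
  (forall j, h (x j) = Some (y j)) ->
  h (fun i => fin_op (fun j => x j i)) = Some (fin_op y).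
Proof.
move=> [_ hh] hxy.
pose z (j : 'I_(arity f)) (i : 'I_k.+1) : M :=
  if unlift ord_max i is Some i' then x j i' else y j.
have zl j : z j \o lift ord_max = x j.
  by apply: funext => i; rewrite /z /= liftK.
have zm j : z j ord_max = y j by rewrite /z unlift_none.
have {}hh : h (fun i => fin_op (fun j => (z j \o lift ord_max) i)) =
    Some (fin_op (fun j => z j ord_max)).
  by apply: (hh f z) => j; rewrite /graph /= zl zm.
have -> : y = fun j => z j ord_max by apply: funext.
rewrite -hh; congr h; apply: funext => i; congr fin_op; apply: funext => j.
by rewrite zl.
Qed.

Lemma compatible_opP (g : operation M) (f : Sg)
    (x : 'I_(arity f) -> 'I_(op_arity g) -> M) :
  @compatible_op Sg M g ->
  g (fun i => fin_op (fun j => x j i)) = fin_op (fun j => g (x j)).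
Proof.
move=> hg; apply: Some_inj.
exact: (@compatible_graphP _ (fun x => Some (g x)) f x _ hg).
Qed.

Lemma compatible_relP (r : relation M) (f : Sg)
    (x : 'I_(arity f) -> 'I_(rel_arity r) -> M) :
  @compatible_rel Sg M r -> (forall j, rel_val r (x j)) ->
  rel_val r (fun i => fin_op (fun j => x j i)).
Proof. by move=> [_ hr] /(hr f x). Qed.

Lemma dual_closed (A : algebra Sg) :
  substructure_closed (X := power_structure A) [set x : A -> M | hom x].
Proof.
split=> [g x hx f a|h x y hx hy f a] /=.
- have hg := ego_opsP (set_valP g).
  have /= <- := compatible_opP (fun j i => x i (a j)) hg.
  by congr op_val; apply: funext => i; rewrite hx.
- have hh := ego_popsP (set_valP h).
  move/power_popP : hy => hy.
  have := compatible_graphP hh (fun j => hy (a j)).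
  rewrite (_ : (fun i => _) = fun k => x k (op a)) ?hy => [[]//|].
  by apply: funext => i; rewrite hx.
Qed.

(* [dual], [predual], [eval_alg] and [eval_str] are usually written D, E, e and
   epsilon. *)
Definition dual (A : algebra Sg) : structure := substructure (dual_closed A).

Lemma dual_topologically_closed (A : algebra Sg) :
  closed [set x : power_structure A | @hom Sg A M x].
Proof.
move=> x cx f a.
have nbhs_x : Filter (nbhs x) by exact: nbhs_filter.
have near_eq b : \forall y \near x, (y : A -> M) b = x b.
  have := @proj_continuous {classic A} (fun=> ego_space M) b x.
  move=> /(_ [set y | y = x b]); rewrite nbhs_principalE.
  by apply; apply/principal_filterP.
have near_args : \forall y \near x, forall j, (y : A -> M) (a j) = x (a j).
  exact: (@filter_forall (power_structure A) 'I_(arity f)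
    (fun j (y : A -> M) => y (a j) = x (a j)) _ nbhs_x
    (fun j => near_eq (a j))).
have [y [hy [yop ya]]] := cx _ (filterI (near_eq (op a)) near_args).
rewrite -yop hy; congr fin_op; apply: funext => j; exact: ya.
Qed.

Lemma continuous_fin_op (X : topologicalType) (f : Sg)
    (a : 'I_(arity f) -> X -> ego_space M) :
  (forall j, continuous (a j)) ->
  continuous (fun x => fin_op (fun j => a j x) : ego_space M).
Proof.
move=> ca x A; rewrite nbhs_principalE => /principal_filterP Ax.
have eqa : \forall z \near x, forall j, a j z = a j x.
  apply: filter_forall => j.
  by apply: (ca j x [set y | y = a j x]); rewrite nbhs_principalE;
    apply/principal_filterP.
apply: filterS eqa => z eqz /=.
by rewrite (_ : (fun j => a j z) = fun j => a j x) //; apply: funext.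
Qed.

Lemma predual_closed (X : structure) :
  @subuniverse Sg (alg_power M X)
    [set a : X -> M | morphism (Y := ego_structure) a].
Proof.
move=> f a ha; split.
- by apply: continuous_fin_op => j; have [] := ha j.
- move=> g x /=; have hg := ego_opsP (set_valP g).
  rewrite (compatible_opP (fun j i => a j (x i)) hg).
  by congr fin_op; apply: funext => j; have [_ -> _ _] := ha j.
- move=> h x y hxy /=; have hh := ego_popsP (set_valP h).
  apply: (compatible_graphP hh) => j.
  by have [_ _ /(_ h x y hxy)] := ha j.
- move=> r x hx /=; have hr := ego_relsP (set_valP r).
  apply: (compatible_relP (x := fun j i => a j (x i)) hr) => j.
  by have [_ _ _ /(_ r x hx)] := ha j.
Qed.

Definition predual (X : structure) : algebra Sg :=
  subalgebra (@predual_closed X).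

Lemma eval_morphism (A : algebra Sg) (a : A) :
  morphism (X := dual A) (Y := ego_structure) (fun x => val x a).
Proof.
split=> //.
- move=> x.
  apply: (@continuous_comp (dual A) (power_structure A) (ego_space M)
    val (fun y => y a)).
    exact: (@initial_continuous (dual A) (power_structure A) val).
  exact: (@proj_continuous {classic A} (fun=> ego_space M) a (val x)).
- move=> h x y /=.
  case e : power_pop => [z|//] /=; case: insubP => // u _ uz [<-].
  by rewrite uz; move/power_popP: e; apply.
- by move=> r x hx; exact: hx.
Qed.

Definition eval_alg (A : algebra Sg) (a : A) : predual (dual A) :=
  SigSub (mem_set (eval_morphism a)).

Lemma eval_hom (X : structure) (x : X) :
  @hom Sg (predual X) M (fun a => val a x).
Proof. by []. Qed.

Definition eval_str (X : structure) (x : X) : dual (predual X) :=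
  SigSub (mem_set (@eval_hom X x)).

Lemma dual_IScP (A : algebra Sg) : inhabited A -> IScP (dual A).
Proof.
move=> A0; exists A, _, (dual_closed A), id; split=> //.
  exact: dual_topologically_closed.
suff id_morphism : morphism (X := dual A) (Y := dual A) id.
  by split=> //; exists id; split.
by split=> // x; exact: cvg_id.
Qed.

Definition yields_duality : Prop :=
  forall A : algebra Sg, ISP M A -> alg_isomorphism (@eval_alg A).

Definition yields_full_duality : Prop :=
  yields_duality /\
  forall X : structure, IScP X -> isomorphism (@eval_str X).

Definition ego_injective : Prop :=
  forall (X Y : structure) (phi : X -> Y) (a : X -> ego_structure),
    IScP X -> IScP Y -> embedding phi -> morphism a ->
    exists b : Y -> ego_structure, morphism b /\ b \o phi = a.

Definition yields_strong_duality : Prop :=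
  yields_full_duality /\ ego_injective.

End Structures.

Section Modify.
Variables (Sg : signature) (M : fin_algebra Sg) (E : alter_ego M).

Definition remove_op (g : operation M) : alter_ego M :=
  AlterEgo (subset_trans (@subDsetl _ (ego_ops E) [set g]) (@ego_opsP _ _ E))
    (@ego_popsP _ _ E) (@ego_relsP _ _ E).

Definition remove_pop (h : partial_operation M) : alter_ego M :=
  AlterEgo (@ego_opsP _ _ E)
    (subset_trans (@subDsetl _ (ego_pops E) [set h]) (@ego_popsP _ _ E))
    (@ego_relsP _ _ E).

Definition remove_rel (r : relation M) : alter_ego M :=
  AlterEgo (@ego_opsP _ _ E) (@ego_popsP _ _ E)
    (subset_trans (@subDsetl _ (ego_rels E) [set r]) (@ego_relsP _ _ E)).

Definition yields_optimal_duality : Prop :=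
  [/\ yields_duality E,
      forall g, ego_ops E g -> ~ yields_duality (remove_op g),
      forall h, ego_pops E h -> ~ yields_duality (remove_pop h) &
      forall r, ego_rels E r -> ~ yields_duality (remove_rel r)].

Definition compatible_pops (k : nat) : set (partial_operation M) :=
  [set h | pop_arity h = k /\ @compatible_pop Sg M h].

Lemma add_pops_subproof (k : nat) :
  ego_pops E `|` compatible_pops k `<=` @compatible_pop Sg M.
Proof. by move=> h [/ego_popsP|[]]. Qed.

Definition add_pops (k : nat) : alter_ego M :=
  AlterEgo (@ego_opsP _ _ E) (@add_pops_subproof k) (@ego_relsP _ _ E).

End Modify.

Inductive J (n : nat) :=
  | Top | Bot | f_ of 'I_n.+1 | t_ of 'I_n.+1.

Arguments Top {n}.
Arguments Bot {n}.

Section JFinite.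
Variable n : nat.

Definition J_encode (x : J n) : bool + bool * 'I_n.+1 :=
  match x with
  | Top => inl true | Bot => inl false
  | f_ i => inr (false, i) | t_ i => inr (true, i)
  end.

Definition J_decode (x : bool + bool * 'I_n.+1) : J n :=
  match x with
  | inl true => Top | inl false => Bot
  | inr (false, i) => f_ i | inr (true, i) => t_ i
  end.

Lemma J_encodeK : cancel J_encode J_decode. Proof. by case. Qed.

HB.instance Definition _ := Finite.copy (J n) (can_type J_encodeK).

Lemma card_J : #|{: J n}| = (n.*2 + 4)%N.
Proof.
have J_decodeK : cancel J_decode J_encode by case=> [[]|[[] i]].
rewrite (bij_eq_card (Bijective J_encodeK J_decodeK)).
by rewrite card_sum card_prod !card_bool card_ord mul2n doubleS addnC addn2 addn4.
Qed.

(* k stands for the knowledge order and t for the truth order; [kmeetP],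
   [kjoinP], [tmeetP] and [tjoinP] show that the operations are the lattice
   operations of these orders. *)
Definition kle (x y : J n) : bool :=
  match x, y with
  | Bot, _ | _, Top => true
  | f_ i, f_ j | t_ i, t_ j => (j <= i)%N
  | _, _ => false
  end.

Definition tle (x y : J n) : bool :=
  match x, y with
  | f_ i, f_ j => (i <= j)%N
  | t_ i, t_ j => (j <= i)%N
  | f_ _, _ | _, t_ _ => true
  | Top, Top | Bot, Bot => true
  | _, _ => false
  end.

Definition kmeet (x y : J n) : J n :=
  match x, y with
  | Top, z | z, Top => z
  | f_ i, f_ j => f_ (Order.max i j)
  | t_ i, t_ j => t_ (Order.max i j)
  | _, _ => Bot
  end.

Definition kjoin (x y : J n) : J n :=
  match x, y with
  | Bot, z | z, Bot => z
  | f_ i, f_ j => f_ (Order.min i j)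
  | t_ i, t_ j => t_ (Order.min i j)
  | _, _ => Top
  end.

Definition tmeet (x y : J n) : J n :=
  match x, y with
  | f_ i, f_ j => f_ (Order.min i j)
  | f_ i, _ | _, f_ i => f_ i
  | t_ i, t_ j => t_ (Order.max i j)
  | t_ _, z | z, t_ _ => z
  | Top, Top => Top
  | Bot, Bot => Bot
  | _, _ => f_ ord_max
  end.

Definition tjoin (x y : J n) : J n :=
  match x, y with
  | t_ i, t_ j => t_ (Order.min i j)
  | t_ i, _ | _, t_ i => t_ i
  | f_ i, f_ j => f_ (Order.max i j)
  | f_ _, z | z, f_ _ => z
  | Top, Top => Top
  | Bot, Bot => Bot
  | _, _ => t_ ord_max
  end.

Definition neg (x : J n) : J n :=
  match x with
  | Top => Top | Bot => Bot | f_ i => t_ i | t_ i => f_ i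
  end.

Lemma kle_partial_order : [/\ reflexive kle, antisymmetric kle & transitive kle].
Proof.
split=> [[]//=|[||i|i] [||j|j]//= ij|[||i|i] [||j|j] [||k|k]//= ij jk].
- by congr f_; apply/val_inj/anti_leq; rewrite andbC.
- by congr t_; apply/val_inj/anti_leq; rewrite andbC.
- exact: leq_trans ij.
- exact: leq_trans ij.
Qed.

Lemma tle_partial_order : [/\ reflexive tle, antisymmetric tle & transitive tle].
Proof.
split=> [[]//=|[||i|i] [||j|j]//= ij|[||i|i] [||j|j] [||k|k]//= ij jk].
- by congr f_; apply/val_inj/anti_leq.
- by congr t_; apply/val_inj/anti_leq; rewrite andbC.
- exact: leq_trans jk.
- exact: leq_trans ij.
Qed.

Lemma leq_ordE (i j : 'I_n.+1) : (i <= j)%N = (i <= j)%O.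
Proof. by []. Qed.

Lemma kmeetP z x y : kle z (kmeet x y) = kle z x && kle z y.
Proof.
by case: x y z => [||i|i] [||j|j] [||k|k] //=;
  rewrite ?andbT ?andbF // !leq_ordE ge_max.
Qed.

Lemma kjoinP z x y : kle (kjoin x y) z = kle x z && kle y z.
Proof.
by case: x y z => [||i|i] [||j|j] [||k|k] //=;
  rewrite ?andbT ?andbF // !leq_ordE le_min.
Qed.

Lemma tmeetP z x y : tle z (tmeet x y) = tle z x && tle z y.
Proof.
case: x y z => [||i|i] [||j|j] [||k|k] //=;
  rewrite ?andbT ?andbF ?leq_ord // ?leq_ordE ?ge_max ?le_min //.
Qed.

Lemma tjoinP z x y : tle (tjoin x y) z = tle x z && tle y z.
Proof.
by case: x y z => [||i|i] [||j|j] [||k|k] //=;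
  rewrite ?andbT ?andbF ?leq_ord // ?leq_ordE ?ge_max ?le_min.
Qed.

End JFinite.

Inductive J_symbol (n : nat) :=
  | Kmeet | Kjoin | Tmeet | Tjoin | Neg | Const of J n.

Definition J_arity (n : nat) (f : J_symbol n) : nat :=
  match f with
  | Kmeet | Kjoin | Tmeet | Tjoin => 2
  | Neg => 1
  | Const _ => 0
  end.

Definition J_signature (n : nat) : signature := Signature (@J_arity n).

Definition J_op (n : nat) (f : J_symbol n) : ('I_(J_arity f) -> J n) -> J n :=
  match f with
  | Kmeet => fun x => kmeet (x ord0) (x ord_max)
  | Kjoin => fun x => kjoin (x ord0) (x ord_max)
  | Tmeet => fun x => tmeet (x ord0) (x ord_max)
  | Tjoin => fun x => tjoin (x ord0) (x ord_max)
  | Neg => fun x => neg (x ord0)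
  | Const c => fun _ => c
  end.

Definition J_algebra (n : nat) : fin_algebra (J_signature n) :=
  @FinAlgebra (J_signature n) (J n) (@J_op n).

Section JRelations.
Variable n : nat.

Definition F_set : set (J n) := range (@f_ n).
Definition T_set : set (J n) := range (@t_ n).

(* [S_lt i] is the relation $S_{n,i}$ for i < n, and [S_eq] is $S_{n,n}$. *)
Definition S_lt (i : nat) : set (J n * J n) :=
  [set (Top, Top); (Bot, Bot)] `|`
  ((F_set `*` F_set) `\`
     ([set f_ a | a in [set a : 'I_n.+1 | (a <= i)%N]] `*`
      [set f_ a | a in [set a : 'I_n.+1 | (i < a)%N]])) `|`
  ((T_set `*` T_set) `\`
     ([set t_ a | a in [set a : 'I_n.+1 | (a <= i)%N]] `*`
      [set t_ a | a in [set a : 'I_n.+1 | (i < a)%N]])).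

Definition S_eq : set (J n * J n) :=
  (setT `*` [set Top]) `|` ([set Bot] `*` setT) `|`
  (F_set `*` F_set) `|` (T_set `*` T_set).

Definition S_ (i : nat) : set (J n * J n) := if (i < n)%N then S_lt i else S_eq.

Definition R_ (i j : nat) : set (J n * J n) := S_ i `|` S_ j.

(* The second family is empty for n <= 2, see [rels_small]. *)
Definition rels : set (set (J n * J n)) :=
  [set S_ i | i in [set i | (i <= n)%N]] `|`
  [set r | exists i j, [/\ (i < n)%N, (j < n)%N, (i < j.-1)%N & r = R_ i j]].

Lemma rels_small : (n <= 2)%N -> rels = [set S_ i | i in [set i | (i <= n)%N]].
Proof.
move=> n_le2; apply/seteqP; split=> r; last by left.
by move=> [//|[i [j [_ ltjn ltij _]]]]; lia.
Qed.

End JRelations.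

Arguments S_lt n i _ : clear implicits.
Arguments S_eq n _ : clear implicits.
Arguments S_ n i _ : clear implicits.
Arguments R_ n i j _ : clear implicits.
Arguments rels n _ : clear implicits.

Definition binary_relation (M : Type) (r : set (M * M)) : relation M :=
  @Relation M 2 [set x : 'I_2 -> M | r (x ord0, x ord_max)].

Section JCompatible.
Variable n : nat.

Definition J_rel (p : rel nat) : set (J n * J n) := fun xy =>
  match xy with
  | (Top, Top) | (Bot, Bot) => true
  | (f_ a, f_ b) | (t_ a, t_ b) => p a b
  | _ => false
  end.

Lemma J_rel_compatible (p : rel nat) : reflexive p ->
  (forall a b c d, p a b -> p c d -> p (maxn a c) (maxn b d)) ->
  (forall a b c d, p a b -> p c d -> p (minn a c) (minn b d)) ->
  @compatible_rel _ (J_algebra n) (binary_relation (J_rel p)).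
Proof.
move=> p_refl p_max p_min; split; first by exists (fun=> Top).
have ord_maxE (a c : 'I_n.+1) : nat_of_ord (Order.max a c) = maxn a c.
  by case: (leP a c) => ac; [rewrite (maxn_idPr _)|rewrite (maxn_idPl _) // ltnW].
have ord_minE (a c : 'I_n.+1) : nat_of_ord (Order.min a c) = minn a c.
  by case: (leP a c) => ac; [rewrite (minn_idPl _)|rewrite (minn_idPr _) // ltnW].
case=> [||||| c] x px; rewrite /= /binary_relation /=; last first.
  by case: (c) => [||a|a] //=; exact: p_refl.
- move: (px ord0); rewrite /binary_relation /=.
  by case: (x ord0 ord0) (x ord0 ord_max) => [||a|a] [||b|b].
all: move: (px ord0) (px ord_max); rewrite /binary_relation /=.
all: case: (x ord0 ord0) (x ord0 ord_max) => [||a|a] [||b|b] //= pab.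
all: case: (x ord_max ord0) (x ord_max ord_max) => [||c|c] [||d|d] //= pcd.
all: rewrite ?ord_maxE ?ord_minE; solve [exact: p_max | exact: p_min | exact: p_refl].
Qed.

Lemma S_eq_compatible :
  @compatible_rel _ (J_algebra n) (binary_relation (S_eq n)).
Proof.
pose p (x y : J n) := match x, y with
  | _, Top | Bot, _ | f_ _, f_ _ | t_ _, t_ _ => true | _, _ => false end.
have -> : S_eq n = [set xy | p xy.1 xy.2].
  apply/seteqP; split=> -[x y]; rewrite /S_eq /=.
    by move=> [[[[_ ->]|[-> _]]|[[a _ <-] [b _ <-]]]|[[a _ <-] [b _ <-]]] //;
      [case: x | case: y].
  case: x y => [||a|a] [||b|b] //= _; do ?[by left; left; left
    | by left; left; right | by left; right; split; eexists
    | by right; split; eexists].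
split; first by exists (fun=> Top).
case=> [||||| c] x px; rewrite /= /binary_relation /=; last first.
  by case: (c).
- move: (px ord0); rewrite /binary_relation /=.
  by case: (x ord0 ord0) (x ord0 ord_max) => [||a|a] [||b|b].
all: move: (px ord0) (px ord_max); rewrite /binary_relation /=.
all: case: (x ord0 ord0) (x ord0 ord_max) => [||a|a] [||b|b] //= pab.
all: by case: (x ord_max ord0) (x ord_max ord_max) => [||c|c] [||d|d].
Qed.

Lemma S_ltE (i : nat) :
  S_lt n i = J_rel (fun a b => ~~ ((a <= i) && (i < b))%N).
Proof.
apply/seteqP; split=> -[x y]; rewrite /S_lt /=.
  move=> [[[[-> ->]|[-> ->]]|[[[a _ <-] [b _ <-]] h]]|[[[a _ <-] [b _ <-]] h]] //=;
    by apply/negP => /andP[ai ib]; case: h; split; [exists a | exists b].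
case: x y => [||a|a] [||b|b] //= nab; first by left; left; left.
- by left; left; right.
- left; right; split; first by split; eexists.
  by move=> [[c ci [ca]] [d di [db]]]; subst; rewrite ci di in nab.
- right; split; first by split; eexists.
  by move=> [[c ci [ca]] [d di [db]]]; subst; rewrite ci di in nab.
Qed.

Lemma S_lt_compatible (i : nat) :
  @compatible_rel _ (J_algebra n) (binary_relation (S_lt n i)).
Proof.
by rewrite S_ltE; apply: J_rel_compatible => [a|a b c d|a b c d]; lia.
Qed.

Lemma S_compatible (i : nat) :
  @compatible_rel _ (J_algebra n) (binary_relation (S_ n i)).
Proof.
by rewrite /S_; case: ifP => _; [exact: S_lt_compatible|exact: S_eq_compatible].
Qed.

Lemma R_compatible (i j : nat) : (i < n)%N -> (j < n)%N ->
  @compatible_rel _ (J_algebra n) (binary_relation (R_ n i j)).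
Proof.
move=> ltin ltjn; rewrite /R_ /S_ ltin ltjn !S_ltE.
have -> (p q : rel nat) :
    J_rel p `|` J_rel q = J_rel (fun a b => p a b || q a b).
  apply/seteqP; split=> -[[||a|a] [||b|b]] /=;
    by [move=> []; auto | left | move=> [] ->; rewrite ?orbT | move=> /orP].
by apply: J_rel_compatible => [a|a b c d|a b c d]; lia.
Qed.

End JCompatible.

Lemma J_ego_relsP (n : nat) :
  [set binary_relation r | r in rels n] `<=`
  @compatible_rel (J_signature n) (J_algebra n).
Proof.
move=> _ [_ [[i _ <-]|[i [j [ltin ltjn _ ->]]]] <-]; first exact: S_compatible.
exact: R_compatible.
Qed.

Definition J_ego (n : nat) : alter_ego (J_algebra n) :=
  @AlterEgo (J_signature n) (J_algebra n) set0 set0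
    [set binary_relation r | r in rels n]
    (@sub0set _ _) (@sub0set _ _) (@J_ego_relsP n).

(* Main.v *)
Require Import Defs.
From mathcomp Require Import all_boot all_order zify all_classical.
From mathcomp Require Import topology_structure discrete_topology compact.
From mathcomp Require Import initial_topology supremum_topology.
From mathcomp Require Import subtype_topology subspace_topology function_spaces.

(**
Duality. A morphism alpha on a dual agrees at any two points x, y with an
evaluation: {(x(a), y(a))} is a subuniverse of J_n^2 containing the diagonal, and
such a subuniverse is an intersection of relations S_{n,n}, S_{n,i}, R_{n,i,j} and
their converses. Here R_{n,i,i+1} need not be in the alter ego, because
x R_{n,i,i+1} y gives a homomorphism z with x S_{n,i} z S_{n,i+1} y. Since the
truth order is a lattice order, finite meets over y followed by finite joins over
x turn the two-point interpolants into an element a with alpha = e(a); finiteness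
comes from compactness.

Strength. For a closed substructure X of a power, a homomorphism u : E(X) -> J_n
agrees, at each of the n thresholds f_k / f_{k+1}, with the evaluation at some
point x_k of X, again by compactness. The thresholds separate J_n, so u is the
value at (x_0, ..., x_{n-1}) of a compatible n-ary partial operation, hence the
evaluation at a point of X; for n <= 1 a single point suffices. Injectivity
is the interpolation argument with E(Y) in place of the algebra.

Optimality. When r is removed, the algebra r itself is a counterexample: compose
the evaluation at c with a map g such that (g(c_1), g(c_2)) is not in r, where
c = (bot, top) for S_{n,n} and c = (f_n, f_0) otherwise.
*)

Set Implicit Arguments.
Unset Strict Implicit.
Unset Printing Implicit Defensive.

Import Order.TTheory.
Local Open Scope classical_set_scope.
Local Open Scope card_scope.

(** * Coordinates of closed substructures of powers *)

(** If [Q setT] failed, the complements of the sets in [Q] would form a proper filter; a cluster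
    point of it has a neighbourhood in [Q], whose complement belongs to the filter. *)
Lemma compact_cover_ind (X : topologicalType) (Q : set X -> Prop) :
  compact [set: X] -> Q set0 ->
  (forall U V, U `<=` V -> Q V -> Q U) ->
  (forall U V, Q U -> Q V -> Q (U `|` V)) ->
  (forall x : X, exists2 U, nbhs x U & Q U) -> Q setT.
Proof.
move=> cX Q0 Qsub QU Qloc; apply: contrapT => nQ.
pose F : set_system X := [set A | Q (~` A)].
have FF : ProperFilter F.
  split; first by rewrite /F /= setC0.
  split.
  - by rewrite /F /= setCT.
  - by move=> A B QA QB; rewrite -[F _]/(Q _) setCI; exact: QU.
  - by move=> A B AB; apply: Qsub; exact: subsetC.
have [|x [_ Fx]] := cX F FF; first by rewrite /F /= setCT.
have [U xU QU'] := Qloc x.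
by have [|y []] := Fx (~` U) U _ xU; rewrite /F /= ?setCK.
Qed.

Lemma compact_set_type (X : topologicalType) (S : set X) :
  compact S -> compact [set: set_type S].
Proof.
move=> cS F FF _.
have [|p [Sp Fp]] := cS (val @ F) (fmap_proper_filter _ FF).
  by apply: (@filterS _ F _ setT) => [x _|]; [exact: (set_valP x)|exact: filterT].
exists (SigSub (mem_set Sp)); split=> // A B FA [C [[D oD <-] /= Dp] CB].
have [|x [[y Ay yx] Dx]] := Fp (val @` A) D _ (open_nbhs_nbhs (conj oD Dp)).
  by apply: (@filterS _ F _ A) FA => x Ax; exists x.
by exists y; split=> //; apply: CB => /=; rewrite -yx in Dx.
Qed.

Lemma continuous_to_ptws (X Y : topologicalType) (I : Type)
    (g : X -> {ptws I -> Y}) :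
  (forall i, continuous (fun x => g x i)) -> continuous g.
Proof.
move=> cg x; apply/cvg_sup => i.
exact: (@continuous_comp_initial _ _ _ (fun f : I -> Y => f i) g (cg i)).
Qed.

Section Coordinates.
Variables (Sg : signature) (M : fin_algebra Sg) (E : alter_ego M).

Lemma ego_space_near (X : topologicalType) (g : X -> ego_space M) (x : X) :
  continuous g -> \forall y \near x, g y = g x.
Proof.
move=> cg; apply: (cg x [set y | y = g x]).
by rewrite nbhs_principalE; apply/principal_filterP.
Qed.

Lemma compact_power (I : Type) : compact [set: power_structure E I].
Proof.
have := @tychonoff {classic I} (fun=> ego_space M) (fun=> setT).
rewrite (_ : [set f | _] = setT); last by apply/seteqP; split.
by apply=> _; apply: finite_compact; exact: (@finite_finset (fin_carrier M)).
Qed.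

Lemma morphism_comp (X Y Z : structure E) (phi : X -> Y) (psi : Y -> Z) :
  morphism phi -> morphism psi -> morphism (psi \o phi).
Proof.
move=> [c1 o1 p1 r1] [c2 o2 p2 r2]; split.
- by move=> x; apply: continuous_comp; [exact: c1|exact: c2].
- by move=> g x /=; rewrite o1 o2.
- by move=> h x y /p1/p2.
- by move=> r x /r1/r2.
Qed.

(* A compact structure presented as a closed substructure of a power, without
   mentioning the power: [rho i] is the i-th coordinate map. *)
Record coordinates (X : structure E) (I : Type) (rho : I -> X -> fin_carrier M)
    : Prop := Coordinates {
  coord_compact : compact [set: X];
  coord_morphism : forall i, morphism (Y := ego_structure E) (rho i);
  coord_inj : forall x y, (forall i, rho i x = rho i y) -> x = y;
  coord_rel : forall (r : ego_rels E) (x : 'I_(rel_arity (val r)) -> X),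
    (forall i, rel_val (val r) (rho i \o x)) -> srel x;
  coord_pop : forall (h : ego_pops E) (x : 'I_(pop_arity (val h)) -> X)
      (y : I -> fin_carrier M),
    (forall i, val h (rho i \o x) = Some (y i)) ->
    exists2 z, spop x = Some z & forall i, rho i z = y i;
  coord_continuous : forall (Z : topologicalType) (g : Z -> X),
    (forall i, continuous (fun z => rho i (g z) : ego_space M)) ->
    continuous g
}.

Lemma coordinates_power (I : Type) :
  @coordinates (power_structure E I) I (fun i x => x i).
Proof.
split.
- exact: compact_power.
- move=> i; split=> //.
  + exact: (@proj_continuous {classic I} (fun=> ego_space M) i).
  + by move=> h x y /power_popP/(_ i).
  + by move=> r x; apply.
- by move=> x y xy; apply: funext.
- by [].
- by move=> h x y hxy; exists y => //; apply/power_popP.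
- by move=> Z g cg; exact: continuous_to_ptws.
Qed.

Lemma coordinates_sub (X : structure E) (I : Type)
    (rho : I -> X -> fin_carrier M) (S : set X) (hS : substructure_closed S) :
  coordinates rho -> closed S ->
  @coordinates (substructure hS) I (fun i x => rho i (val x)).
Proof.
case=> cX mor inj rl pop cont clS; split.
- apply: compact_set_type.
  exact: subclosed_compact clS cX (@subsetT _ S).
- move=> i; apply: (@morphism_comp (substructure hS) X) (mor i); split=> //.
  + exact: (@initial_continuous (substructure hS) X val).
  + move=> h x y /=; case: spop => //= z; case: insubP => // u _ uz [<-].
    by rewrite uz.
- by move=> x y xy; apply/val_inj/inj.
- by move=> r x rx; apply: rl.
- move=> h x y /pop[z xz zy].
  have Sz : S z by apply: (hS.2 h _ _ _ xz) => k; exact: set_valP.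
  exists (SigSub (mem_set Sz)) => //=.
  rewrite [X in obind _ X]xz /= insubT ?mem_set // => zS.
  by congr Some; apply: val_inj.
- move=> Z g cg.
  exact/(@continuous_comp_initial _ Z X val g)/cont.
Qed.

Lemma coordinates_iso (X Y : structure E) (I : Type)
    (rho : I -> Y -> fin_carrier M) (phi : X -> Y) :
  isomorphism phi -> coordinates rho ->
  coordinates (fun i x => rho i (phi x)).
Proof.
move=> [mphi [psi [mpsi phiK psiK]]] [cY mor inj rl pop cont].
have [cphi ophi pphi rphi] := mphi.
have [cpsi opsi ppsi rpsi] := mpsi.
split.
- have -> : [set: X] = psi @` setT.
    by apply/seteqP; split=> // x _; exists (phi x).
  by apply: continuous_compact => //; exact: continuous_subspaceT.
- by move=> i; apply: morphism_comp (mor i).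
- by move=> x y /inj/(can_inj phiK).
- move=> r x /rl/rpsi; congr (srel _); apply: funext => k /=.
  by rewrite phiK.
- move=> h x y /pop[z xz zy]; exists (psi z); last by move=> i; rewrite psiK.
  rewrite -(ppsi _ _ _ xz); congr spop; apply: funext => k /=.
  by rewrite phiK.
- move=> Z g /cont cg.
  have -> : g = psi \o (phi \o g) by apply: funext => z /=; rewrite phiK.
  by move=> z; apply: continuous_comp; [exact: cg|exact: cpsi].
Qed.

Lemma coordinates_IScP (X : structure E) : IScP X ->
  exists (I : Type) (rho : I -> X -> fin_carrier M), coordinates rho.
Proof.
move=> [I [S [hS [phi [_ clS iphi]]]]]; exists I; eexists.
apply: coordinates_iso iphi _.
exact: coordinates_sub (coordinates_power I) clS.
Qed.

Lemma coordinates_embedding (X Y : structure E) (I : Type)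
    (rho : I -> Y -> fin_carrier M) (phi : X -> Y) :
  embedding phi -> coordinates rho -> coordinates (fun i x => rho i (phi x)).
Proof.
move=> [S [hS [psi [clS ipsi phiE]]]] crho.
have := coordinates_iso ipsi (coordinates_sub hS crho clS).
congr coordinates; apply: funext => i; apply: funext => x.
by rewrite phiE.
Qed.

Lemma coordinates_dual (A : algebra Sg) :
  @coordinates (dual E A) A (fun a x => val x a).
Proof.
exact: coordinates_sub (coordinates_power A) (@dual_topologically_closed _ _ E A).
Qed.

(** The structure on [Y] is initial for its coordinate maps: [coord_pop] supplies definedness and a
    value, and [coord_inj] identifies that value. *)
Lemma coordinates_universal (X Y : structure E) (I : Type)
    (rho : I -> Y -> fin_carrier M) (g : X -> Y) :
  coordinates rho ->
  (forall i, morphism (Y := ego_structure E) (rho i \o g)) -> morphism g.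
Proof.
move=> [_ mor inj rl pop cont] mg; split.
- by apply: cont => i; have [] := mg i.
- move=> f x; apply: inj => i.
  have [_ -> _ _] := mor i; have [_ /(_ f x) /= -> _ _] := mg i.
  by [].
- move=> h x y xy.
  have [|z -> zy] := pop h (g \o x) (fun i => rho i (g y)).
    by move=> i; have [_ _ /(_ h x y xy)] := mg i.
  by congr Some; apply: inj.
- by move=> r x rx; apply: rl => i; have [_ _ _ /(_ r x rx)] := mg i.
Qed.

Lemma eval_str_morphism (X : structure E) :
  morphism (@eval_str Sg M E X).
Proof.
apply: coordinates_universal (coordinates_dual _) _ => a.
exact: set_valP.
Qed.

(** The inverse picks a representing point for each homomorphism. Followed by [rho i] it is
    evaluation at the element [rhoE i] of the predual, hence a morphism. *)
Lemma eval_str_isomorphism (X : structure E) (I : Type)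
    (rho : I -> X -> fin_carrier M) :
  coordinates rho ->
  (forall u : predual X -> fin_carrier M, @hom _ (predual X) M u ->
    exists x, forall a : predual X, u a = val a x) ->
  isomorphism (@eval_str Sg M E X).
Proof.
move=> crho rep; split; first exact: eval_str_morphism.
pose rhoE i : predual X := SigSub (mem_set (coord_morphism crho i)).
have /choice[psi psiE] : forall u : dual E (predual X),
    exists x, forall a : predual X, val u a = val a x.
  by move=> u; apply: rep; exact: set_valP u.
exists psi; split.
- apply: (coordinates_universal crho) => i.
  rewrite (_ : rho i \o psi = fun u => val u (rhoE i)).
    exact: eval_morphism.
  by apply: funext => u; rewrite psiE.
- by move=> x; apply: (coord_inj crho) => i; have /= := psiE (eval_str x) (rhoE i).
- by move=> u; apply/val_inj/funext => a /=; rewrite psiE.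
Qed.

End Coordinates.

(** * Subuniverses of the square of J_n *)

Section BinaryRelations.
Variable n : nat.
Implicit Types (x y p q : J n) (a b c d : 'I_n.+1) (i j : nat).

Definition S_eqb x y : bool :=
  match x, y with
  | _, Top | Bot, _ | f_ _, f_ _ | t_ _, t_ _ => true
  | _, _ => false
  end.

Lemma S_eqE : S_eq n = [set xy | S_eqb xy.1 xy.2].
Proof.
apply/seteqP; split=> -[x y]; rewrite /S_eq /=.
  by move=> [[[[_ ->]|[-> _]]|[[a _ <-] [b _ <-]]]|[[a _ <-] [b _ <-]]] //;
    [case: x | case: y].
case: x y => [||a|a] [||b|b] //= _; do ?[by left; left; left
  | by left; left; right | by left; right; split; eexists
  | by right; split; eexists].
Qed.

(** One shape for all relations but S_{n,n}: [sep i j] excludes the rectangle of first indices up to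
    [i] and second indices above [j]. For [i < j], the union of [sep i i] and [sep j j] excludes
    only the intersection of their rectangles, which is that of [sep i j]. *)
Definition sep i j : rel nat := fun k l => ~~ ((k <= i) && (j < l))%N.

Lemma S_sepE i : (i < n)%N -> S_ n i = @J_rel n (sep i i).
Proof. by move=> lt_in; rewrite /S_ lt_in S_ltE. Qed.

Lemma R_sepE i j : (i < j < n)%N -> R_ n i j = @J_rel n (sep i j).
Proof.
move=> /andP[ltij ltjn]; rewrite /R_ !S_sepE ?(ltn_trans ltij) //.
apply/seteqP; split=> -[[||a|a] [||b|b]] //=; rewrite /sep; try tauto; try lia.
all: by move=> sab; apply/orP; lia.
Qed.


Lemma tmeet_f a b : (a <= b)%N -> tmeet (f_ a) (f_ b) = f_ a.
Proof. by move=> ab; rewrite /= min_l. Qed.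

Lemma tmeetC_f a b : (a <= b)%N -> tmeet (f_ b) (f_ a) = f_ a.
Proof. by move=> ab; rewrite /= min_r. Qed.

Lemma tjoin_f a b : (a <= b)%N -> tjoin (f_ a) (f_ b) = f_ b.
Proof. by move=> ab; rewrite /= max_r. Qed.

Lemma tjoinC_f a b : (a <= b)%N -> tjoin (f_ b) (f_ a) = f_ b.
Proof. by move=> ab; rewrite /= max_l. Qed.

Record diagonal_subuniverse (r : J n -> J n -> Prop) : Prop := {
  ds_const : forall c : J n, r c c;
  ds_kmeet : forall p q p' q', r p q -> r p' q' -> r (kmeet p p') (kmeet q q');
  ds_kjoin : forall p q p' q', r p q -> r p' q' -> r (kjoin p p') (kjoin q q');
  ds_tmeet : forall p q p' q', r p q -> r p' q' -> r (tmeet p p') (tmeet q q');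
  ds_tjoin : forall p q p' q', r p q -> r p' q' -> r (tjoin p p') (tjoin q q');
  ds_neg : forall p q, r p q -> r (neg p) (neg q)
}.

Lemma diagonal_subuniverseC r :
  diagonal_subuniverse r -> diagonal_subuniverse (fun p q => r q p).
Proof. by case=> *; split; auto. Qed.

Section Subuniverse.
Variable r : J n -> J n -> Prop.
Hypothesis rS : diagonal_subuniverse r.

(** Knowledge join and meet of [(Bot, Top)] with [(x, x)] give [(x, Top)] and [(Bot, x)]; truth
    meets and joins of such pairs fill F_n^2 and T_n^2. *)
Lemma ds_BotTop p q : r Bot Top -> S_eqb p q -> r p q.
Proof.
move=> bt.
have toTop x : r x Top.
  by have := ds_kjoin rS bt (ds_const rS x); case: x.
have fromBot x : r Bot x.
  by have := ds_kmeet rS bt (ds_const rS x); case: x.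
case: p q => [||a|a] [||b|b] //= _; try exact: toTop; try exact: fromBot.
- by have := ds_tmeet rS (fromBot (f_ b)) (toTop (f_ a)).
- by have := ds_tjoin rS (fromBot (t_ b)) (toTop (t_ a)).
Qed.

Lemma ds_full p q : r Bot Top -> r Top Bot -> r p q.
Proof.
move=> bt tb.
have toTop x : r x Top by apply: ds_BotTop => //; case: x.
have fromTop x : r Top x.
  by have := ds_kjoin rS tb (ds_const rS x); case: x.
by have := ds_kmeet rS (toTop p) (fromTop q); case: p; case: q.
Qed.

(** The knowledge join of [(f_ a, Bot)] with its negation is [(Top, Bot)], and so is the knowledge
    meet of [(Top, f_ b)] with its negation. The other pairs reduce to these by negation or by a
    meet with [(f_ a, f_ a)]. *)
Lemma ds_TopBot p q : r p q -> ~~ S_eqb p q -> r Top Bot.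
Proof.
have rf a : r (f_ a) Bot -> r Top Bot.
  by move=> fb; have := ds_kjoin rS fb (ds_neg rS fb).
have rt b : r Top (f_ b) -> r Top Bot.
  by move=> fb; have := ds_kmeet rS fb (ds_neg rS fb).
case: p q => [||a|a] [||b|b] //= pq _.
- exact: rt pq.
- exact: (rt b (ds_neg rS pq)).
- exact: rf pq.
- by apply: (rf a); have := ds_kmeet rS pq (ds_const rS (f_ a)); rewrite /= maxxx.
- exact: (rf a (ds_neg rS pq)).
- apply: (rf a); have := ds_kmeet rS (ds_neg rS pq) (ds_const rS (f_ a)).
  by rewrite /= maxxx.
Qed.

(* The maximal interval relation avoiding (f_a, f_b): an element (f_c, f_d) of
   r with c <= a < b <= d would give (f_a, f_b) = ((f_c, f_d) \/ f_a) /\ f_b. *)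
Lemma ds_sep a b : (a < b)%N -> ~ r (f_ a) (f_ b) ->
  forall p q, r p q -> S_eqb p q -> S_eqb q p -> @J_rel n (sep a b.-1) (p, q).
Proof.
move=> ab nr.
have sep_f c d : r (f_ c) (f_ d) -> sep a b.-1 c d.
  move=> cd; apply/negP => /andP[ca bd]; apply: nr.
  have := ds_tmeet rS (ds_tjoin rS cd (ds_const rS (f_ a))) (ds_const rS (f_ b)).
  have [ad bd'] : (a <= d /\ b <= d)%N by lia.
  by rewrite (tjoin_f ca) (tjoinC_f ad) (tmeet_f (ltnW ab)) (tmeetC_f bd').
move=> [||c|c] [||d|d] //= pq _ _; first exact: sep_f.
exact: sep_f (ds_neg rS pq).
Qed.

End Subuniverse.

(** The case [j = i.+1] is included: the relations R_{n,i,i+1} occur as separating relations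
    although [rels n] omits them. *)
Definition basic_rel (s : J n * J n -> Prop) : Prop :=
  s = S_eq n \/ exists i j, (i <= j < n)%N /\ s = @J_rel n (sep i j).

Lemma ds_basic_f r a b : diagonal_subuniverse r ->
  ~ r Bot Top -> ~ r Top Bot -> (a < b)%N -> ~ r (f_ a) (f_ b) ->
  exists2 s, basic_rel s & (forall p q, r p q -> s (p, q)) /\ ~ s (f_ a, f_ b).
Proof.
(* [sep] cuts strictly above its second index, so [b.-1] puts [b] itself into the excluded range. *)
move=> rS nbt ntb ab nr; exists (@J_rel n (sep a b.-1)).
  by right; exists a, b.-1; split=> //; have := ltn_ord b; lia.
split=> [p q pq|]; last by rewrite /= /sep; lia.
apply: (ds_sep rS ab nr pq).
  by apply: contrapT => /negP/(ds_TopBot rS pq).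
by apply: contrapT => /negP/(ds_TopBot (diagonal_subuniverseC rS) pq).
Qed.

Lemma ds_basic r p q : diagonal_subuniverse r -> ~ r p q ->
  exists2 s, basic_rel s &
    ((forall x y, r x y -> s (x, y)) /\ ~ s (p, q)) \/
    ((forall x y, r x y -> s (y, x)) /\ ~ s (q, p)).
Proof.
move=> rS nr; have rC := diagonal_subuniverseC rS.
have [rle|/existsNP[x /existsNP[y /not_implyP[rxy /negP nxy]]]] :=
    pselect (forall x y, r x y -> S_eqb x y); last first.
  (* With [(Top, Bot)] in it, [r] contains the converse of S_{n,n}; leaving that converse as well
     would make [r] full. *)
  have tb := ds_TopBot rS rxy nxy.
  exists (S_eq n); first by left.
  rewrite S_eqE /=; right; split; last by move/(ds_BotTop rC tb)/nr.
  move=> {nxy}{}x {rxy}{}y rxy; apply: contrapT => /negP nyx.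
  exact/nr/(ds_full rS _ _ (ds_TopBot rC rxy nyx) tb).
have [pq|npq] := boolP (S_eqb p q); last first.
  exists (S_eq n); first by left.
  by rewrite S_eqE /=; left; split=> //; exact/negP.
have [rge|/existsNP[x /existsNP[y /not_implyP[rxy /negP nyx]]]] :=
    pselect (forall x y, r x y -> S_eqb y x); last first.
  by case: nr; apply: (ds_BotTop rS _ pq); exact: (ds_TopBot rC rxy nyx).
have [qp|nqp] := boolP (S_eqb q p); last first.
  exists (S_eq n); first by left.
  by rewrite S_eqE /=; right; split=> //; exact/negP.
have nbt : ~ r Bot Top by move/rge.
have ntb : ~ r Top Bot by move/rle.
have base a b : ~ r (f_ a) (f_ b) -> exists2 s, basic_rel s &
    ((forall x y, r x y -> s (x, y)) /\ ~ s (f_ a, f_ b)) \/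
    ((forall x y, r x y -> s (y, x)) /\ ~ s (f_ b, f_ a)).
  case: (ltngtP a b) => [ab|ba|/val_inj->] nab.
  - by have [s bs sP] := ds_basic_f rS nbt ntb ab nab; exists s => //; left.
  - have [s bs [sP ns]] := ds_basic_f rC ntb nbt ba nab.
    by exists s => //; right; split=> // x y /sP.
  - by case: nab; exact: ds_const rS _.
case: p q nr pq qp => [||a|a] [||b|b] //= nr _ _.
- by case: nr; exact: ds_const rS _.
- by case: nr; exact: ds_const rS _.
- exact: base.
(* Negation carries [(t_ a, t_ b)] to [(f_ a, f_ b)], and every basic relation treats the two pairs
   alike. *)
- have [|s bs sP] := base a b; first by move/(ds_neg rS).
  exists s => //; case: bs sP => [->|[i [j [_ ->]]]] //=.
  rewrite S_eqE /=; tauto.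
Qed.

End BinaryRelations.

(** * Interpolation *)

Section Polynomials.
Variables (n : nat) (A : algebra (J_signature n)).

Definition const_term (c : J n) : A :=
  op (f := Const c : J_signature n)
    (fun k : 'I_0 => let: Ordinal _ k_lt0 := k in False_rect A (notF k_lt0)).

Definition neg_term (a : A) : A := op (f := Neg n : J_signature n) (fun=> a).

Definition bin_term (f : J_signature n) (a b : A) : A :=
  op (f := f) (fun k => if nat_of_ord k == 0 then a else b).

Variable h : A -> J n.
Hypothesis hh : @hom _ A (J_algebra n) h.

Lemma hom_const c : h (const_term c) = c.
Proof. exact: hh. Qed.

Lemma hom_neg a : h (neg_term a) = neg (h a).
Proof. exact: hh. Qed.

Lemma hom_kmeet a b : h (bin_term (Kmeet n) a b) = kmeet (h a) (h b).
Proof. exact: hh. Qed.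

Lemma hom_kjoin a b : h (bin_term (Kjoin n) a b) = kjoin (h a) (h b).
Proof. exact: hh. Qed.

Lemma hom_tmeet a b : h (bin_term (Tmeet n) a b) = tmeet (h a) (h b).
Proof. exact: hh. Qed.

Lemma hom_tjoin a b : h (bin_term (Tjoin n) a b) = tjoin (h a) (h b).
Proof. exact: hh. Qed.

End Polynomials.

Lemma diagonal_subuniverse_hom (n : nat) (A : algebra (J_signature n))
    (h k : A -> J n) :
  @hom _ A (J_algebra n) h -> @hom _ A (J_algebra n) k ->
  diagonal_subuniverse (fun p q => exists a, h a = p /\ k a = q).
Proof.
move=> hh hk; split.
- by move=> c; exists (const_term A c); rewrite !hom_const.
- move=> _ _ _ _ [a [<- <-]] [b [<- <-]].
  by exists (bin_term (Kmeet n) a b); rewrite !hom_kmeet.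
- move=> _ _ _ _ [a [<- <-]] [b [<- <-]].
  by exists (bin_term (Kjoin n) a b); rewrite !hom_kjoin.
- move=> _ _ _ _ [a [<- <-]] [b [<- <-]].
  by exists (bin_term (Tmeet n) a b); rewrite !hom_tmeet.
- move=> _ _ _ _ [a [<- <-]] [b [<- <-]].
  by exists (bin_term (Tjoin n) a b); rewrite !hom_tjoin.
- by move=> _ _ [a [<- <-]]; exists (neg_term a); rewrite !hom_neg.
Qed.

Lemma tle_anti (n : nat) (p q : J n) : tle p q -> tle q p -> p = q.
Proof.
by have [_ anti _] := tle_partial_order n; move=> pq qp; apply: anti; rewrite pq.
Qed.

Lemma tle_refl (n : nat) (p : J n) : tle p p.
Proof. by have [rfl _ _] := tle_partial_order n; exact: rfl. Qed.

Lemma tmeet_lel (n : nat) (p q : J n) : tle (tmeet p q) p.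
Proof. by have := tle_refl (tmeet p q); rewrite tmeetP => /andP[]. Qed.

Lemma tmeet_ler (n : nat) (p q : J n) : tle (tmeet p q) q.
Proof. by have := tle_refl (tmeet p q); rewrite tmeetP => /andP[]. Qed.

Lemma tjoin_gel (n : nat) (p q : J n) : tle p (tjoin p q).
Proof. by have := tle_refl (tjoin p q); rewrite tjoinP => /andP[]. Qed.

Lemma tjoin_ger (n : nat) (p q : J n) : tle q (tjoin p q).
Proof. by have := tle_refl (tjoin p q); rewrite tjoinP => /andP[]. Qed.

Section Interpolation.
Variables (n : nat) (X : topologicalType) (A : algebra (J_signature n)).
Variables (ev : X -> A -> J n) (alpha : X -> J n).
Hypothesis cX : compact [set: X].
Hypothesis ev_hom : forall x, @hom _ A (J_algebra n) (ev x).
Hypothesis ev_cont :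
  forall a, continuous (fun x => ev x a : ego_space (J_algebra n)).
Hypothesis alpha_cont : continuous (alpha : X -> ego_space (J_algebra n)).
Hypothesis alpha_basic : forall s, basic_rel s ->
  forall x y, (forall a, s (ev x a, ev y a)) -> s (alpha x, alpha y).

Lemma interpolation_pair x y :
  exists a, ev x a = alpha x /\ ev y a = alpha y.
Proof.
apply: contrapT => nr.
have rS := diagonal_subuniverse_hom (ev_hom x) (ev_hom y).
have [s bs [[rs ns]|[rs ns]]] := ds_basic rS nr; apply: ns.
  by apply: alpha_basic => // a; apply: rs; exists a.
by apply: alpha_basic => // a; apply: rs; exists a.
Qed.

Lemma interpolation_near a x :
  \forall y \near x, ev x a = alpha x -> ev y a = alpha y.
Proof.
have nbhs_x : Filter (nbhs x) by exact: nbhs_filter.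
have near_xa :=
  filterI (ego_space_near x (@ev_cont a)) (ego_space_near x alpha_cont).
by apply: filterS (near_xa nbhs_x) => y [/= -> ->].
Qed.

Lemma interpolation_below x :
  exists a, ev x a = alpha x /\ forall y, tle (ev y a) (alpha y).
Proof.
suff [a [ax ay]] : exists a, ev x a = alpha x /\
    forall y, setT y -> tle (ev y a) (alpha y) by exists a; split=> // y; apply: ay.
apply: (compact_cover_ind (Q := fun V => exists a, ev x a = alpha x /\
  forall y, V y -> tle (ev y a) (alpha y))) => //.
- by have [a [ax _]] := interpolation_pair x x; exists a.
- by move=> U V UV [a [ax aV]]; exists a; split=> // y /UV/aV.
- move=> U V [a [ax aU]] [b [bx bV]]; exists (bin_term (Tmeet n) a b).
  have [_ _ trans] := tle_partial_order n.
  split.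
    by rewrite hom_tmeet // ax bx; case: (alpha x) => //= i; rewrite ?minxx ?maxxx.
  move=> y; rewrite hom_tmeet // => -[/aU|/bV]; apply: trans.
    exact: (tmeet_lel _ _).
  exact: (tmeet_ler _ _).
- move=> y; have [a [ax ay]] := interpolation_pair x y.
  exists [set z | ev z a = alpha z].
    by apply: filterS (interpolation_near a y) => z; exact.
  by exists a; split=> // z ->; exact: tle_refl.
Qed.

Lemma interpolation : exists a, forall x, ev x a = alpha x.
Proof.
suff [a [ax ay]] : exists a, (forall y, tle (ev y a) (alpha y)) /\
    forall y, setT y -> ev y a = alpha y by exists a => x; apply: ay.
apply: (compact_cover_ind (Q := fun V => exists a,
  (forall y, tle (ev y a) (alpha y)) /\ forall y, V y -> ev y a = alpha y)) => //.
(* [f_ ord0] is least for the truth order: it is the empty join. *)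
- exists (const_term A (f_ ord0)); split=> // y.
  by rewrite hom_const //; case: alpha.
- by move=> U V UV [a [ale aV]]; exists a; split=> // y /UV/aV.
- move=> U V [a [ale aU]] [b [ble bV]]; exists (bin_term (Tjoin n) a b).
  have le y : tle (ev y (bin_term (Tjoin n) a b)) (alpha y).
    by rewrite hom_tjoin // tjoinP ale ble.
  split=> // y UVy; apply: tle_anti => //; rewrite hom_tjoin //.
  case: UVy => [/aU<-|/bV<-]; [exact: (tjoin_gel _ _)|exact: (tjoin_ger _ _)].
- move=> x; have [a [ax ale]] := interpolation_below x.
  exists [set z | ev z a = alpha z]; last by exists a.
  by apply: filterS (interpolation_near a x) => z; exact.
Qed.

End Interpolation.

(** * Duality *)

Section Switch.
Variables n i : nat.
Hypothesis lt_i1n : (i.+1 < n)%N.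

(** The bound [i.+1] keeps the result on the same side of threshold [i] as [a]. *)
Definition switch_level (a b : nat) : nat :=
  if (a <= i)%N then a else maxn b i.+1.

(* On R_{n,i,i+1} the thresholds up to i can be read off x and those above i off
   y; this factors R_{n,i,i+1} as S_{n,i} followed by S_{n,i+1}. *)
Definition switch (x y : J n) : J n :=
  match x, y with
  | f_ a, f_ b => f_ (inord (switch_level a b))
  | t_ a, t_ b => t_ (inord (switch_level a b))
  | Top, Top => Top
  | _, _ => Bot
  end.

Lemma switch_ord (a b : 'I_n.+1) :
  nat_of_ord (inord (switch_level a b) : 'I_n.+1) = switch_level a b.
Proof.
have lta := ltn_ord a; have ltb := ltn_ord b.
by rewrite inordK // /switch_level; case: (leqP a i); lia.
Qed.

Lemma val_omax (a b : 'I_n.+1) : nat_of_ord (Order.max a b) = maxn a b.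
Proof.
by case: (leP a b) => ab; [rewrite (maxn_idPr _)|rewrite (maxn_idPl _) // ltnW].
Qed.

Lemma val_omin (a b : 'I_n.+1) : nat_of_ord (Order.min a b) = minn a b.
Proof.
by case: (leP a b) => ab; [rewrite (minn_idPl _)|rewrite (minn_idPr _) // ltnW].
Qed.

(** In the mixed case [a <= i < c] the hypothesis gives [b <= i.+1], so [b] is absorbed by the bound
    in [switch_level]. *)
Lemma switch_max (a b c d : 'I_n.+1) : sep i i.+1 a b -> sep i i.+1 c d ->
  inord (switch_level (Order.max a c) (Order.max b d)) =
  Order.max (inord (switch_level a b)) (inord (switch_level c d)) :> 'I_n.+1.
Proof.
move=> ab cd; apply: val_inj.
rewrite [LHS]switch_ord /= !val_omax !switch_ord /switch_level.
move: ab cd; rewrite /sep.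
by case: (leqP a i); case: (leqP c i); case: (leqP (maxn a c) i); lia.
Qed.

Lemma switch_min (a b c d : 'I_n.+1) : sep i i.+1 a b -> sep i i.+1 c d ->
  inord (switch_level (Order.min a c) (Order.min b d)) =
  Order.min (inord (switch_level a b)) (inord (switch_level c d)) :> 'I_n.+1.
Proof.
move=> ab cd; apply: val_inj.
rewrite [LHS]switch_ord /= !val_omin !switch_ord /switch_level.
move: ab cd; rewrite /sep.
by case: (leqP a i); case: (leqP c i); case: (leqP (minn a c) i); lia.
Qed.

Lemma switch_id (a : 'I_n.+1) : inord (switch_level a a) = a.
Proof.
apply: val_inj; rewrite /= switch_ord /switch_level.
by case: leqP; lia.
Qed.

Lemma switch_op (f : J_signature n) (x y : 'I_(arity f) -> J n) :
  (forall k, @J_rel n (sep i i.+1) (x k, y k)) ->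
  switch (J_op x) (J_op y) = J_op (fun k => switch (x k) (y k)).
Proof.
case: f x y => [||||| c] x y xy /=; last first.
  by case: (c) => [||a|a] //=; rewrite switch_id.
- by move: (xy ord0); case: (x ord0) (y ord0) => [||a|a] [||b|b].
all: move: (xy ord0) (xy ord_max).
all: case: (x ord0) (y ord0) => [||a|a] [||b|b] //= ab.
all: case: (x ord_max) (y ord_max) => [||c|c] [||d|d] //= cd.
all: rewrite ?switch_max ?switch_min ?switch_id //; congr (_ _).
all: exact: (switch_id ord_max).
Qed.

Lemma switch_factor (x y : J n) : @J_rel n (sep i i.+1) (x, y) ->
  @J_rel n (sep i i) (x, switch x y) /\ @J_rel n (sep i.+1 i.+1) (switch x y, y).
Proof.
have factor (a b : 'I_n.+1) : sep i i.+1 a b ->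
    sep i i a (inord (switch_level a b) : 'I_n.+1) /\
    sep i.+1 i.+1 (inord (switch_level a b) : 'I_n.+1) b.
  rewrite switch_ord /sep /switch_level => ab.
  by split; move: ab; case: (leqP a i); lia.
by case: x y => [||a|a] [||b|b] //=; exact: factor.
Qed.

(** If [a <= i], then the middle index is at most [i], and so the last one is at most [i.+1]. *)
Lemma switch_trans (x y z : J n) :
  @J_rel n (sep i i) (x, y) -> @J_rel n (sep i.+1 i.+1) (y, z) ->
  @J_rel n (sep i i.+1) (x, z).
Proof.
have trans (a b c : nat) : sep i i a b -> sep i.+1 i.+1 b c -> sep i i.+1 a c.
  by rewrite /sep; lia.
by case: x y z => [||a|a] [||b|b] [||c|c] //=; exact: trans.
Qed.

Let o0 : 'I_n := Ordinal (ltn_trans (ltn0Sn i) lt_i1n).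
Let o1 : 'I_n := Ordinal (leq_ltn_trans (ltn0Sn i) lt_i1n).

(** A binary partial operation padded with dummy arguments to arity [n], the arity of the operations
    added to the alter ego. *)
Definition switch_pop : partial_operation (J n) :=
  @PartialOperation (J n) n (fun v =>
    if `[< @J_rel n (sep i i.+1) (v o0, v o1) >]
    then Some (switch (v o0) (v o1)) else None).

Lemma switch_pop_val (x y : J n) : @J_rel n (sep i i.+1) (x, y) ->
  switch_pop (fun k : 'I_n => if nat_of_ord k == 0 then x else y) =
  Some (switch x y).
Proof. by move=> xy; rewrite /switch_pop /= asboolT. Qed.

Lemma switch_pop_compatible :
  @compatible_pop (J_signature n) (J_algebra n) switch_pop.
Proof.
split; first by exists (fun=> Top); rewrite /graph /= asboolT.
move=> f x xg; rewrite /graph /=.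
have {}xg k : @J_rel n (sep i i.+1) (x k (lift ord_max o0), x k (lift ord_max o1))
    /\ x k ord_max = switch (x k (lift ord_max o0)) (x k (lift ord_max o1)).
  by move: (xg k); rewrite /graph /=; case: asboolP => // ? [->].
rewrite asboolT.
  rewrite switch_op => [|k]; last by have [] := xg k.
  by congr (Some (J_op _)); apply: funext => k; have [] := xg k.
have [_] : @compatible_rel (J_signature n) (J_algebra n)
    (binary_relation (@J_rel n (sep i i.+1))).
  apply: J_rel_compatible => [a|a b c d|a b c d]; rewrite /sep; lia.
move=> /(_ f (fun k l => if l == ord0 then x k (lift ord_max o0)
  else x k (lift ord_max o1))); apply => k.
by have [] := xg k.
Qed.

End Switch.

Section Duality.
Variables (n : nat) (E : alter_ego (J_algebra n)).
Hypothesis ego_relsE : forall r, rels n r -> ego_rels E (binary_relation r).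

Definition pair_fun (X : Type) (x y : X) (k : 'I_2) : X :=
  if nat_of_ord k == 0 then x else y.

Lemma basic_in_rels (s : J n * J n -> Prop) : basic_rel s ->
  rels n s \/ exists2 i, (i.+1 < n)%N & s = @J_rel n (sep i i.+1).
Proof.
move=> [->|[i [j [/andP[ij jn] ->]]]].
  by left; left; exists n => //=; rewrite /S_ ltnn.
case: (ltngtP j i.+1) => [ji|ji|ji].
- have ->: j = i by lia.
  by left; left; exists i; [rewrite /=; lia|rewrite S_sepE //; lia].
- left; right; exists i, j; split=> //; try lia.
  by rewrite R_sepE //; lia.
- by subst j; right; exists i.
Qed.

Lemma rel_pair (X Y : structure E) (phi : X -> Y) (r : set (J n * J n))
    (nr : rels n r) (x y : X) : morphism phi ->
  srel (s := X) (r := SigSub (mem_set (ego_relsE nr))) (pair_fun x y) ->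
  srel (s := Y) (r := SigSub (mem_set (ego_relsE nr)))
    (pair_fun (phi x) (phi y)).
Proof.
move=> [_ _ _ mr] /mr; congr (srel _); apply: funext => k.
by rewrite /= /pair_fun; case: ifP.
Qed.

(** This provides the intermediate point that factors R_{n,i,i+1}. Duals have it because [switch] of
    two homomorphisms is a homomorphism, other structures because [switch_pop] acts on them. *)
Definition switch_closed (X : Type) (I : Type) (rho : I -> X -> J n) : Prop :=
  forall (i : nat) (x y : X), (i.+1 < n)%N ->
    (forall j, @J_rel n (sep i i.+1) (rho j x, rho j y)) ->
    exists z, forall j, rho j z = switch i (rho j x) (rho j y).

Lemma morphism_basic (X : structure E) (I : Type) (rho : I -> X -> J n)
    (alpha : X -> J n) :
  coordinates rho -> switch_closed rho ->
  morphism (Y := ego_structure E) alpha ->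
  forall s, basic_rel s ->
  forall x y, (forall i, s (rho i x, rho i y)) -> s (alpha x, alpha y).
Proof.
move=> crho sw malpha.
have inrel r : rels n r -> forall x y, (forall i, r (rho i x, rho i y)) ->
    r (alpha x, alpha y).
  move=> nr x y rxy; apply: (rel_pair (nr := nr) malpha).
  by apply: (coord_rel crho) => i; exact: rxy.
move=> s /basic_in_rels[/inrel//|[i lt_i1n ->]] x y sxy.
have [z zE] := sw i x y lt_i1n sxy.
have Sin k : (k < n)%N -> rels n (@J_rel n (sep k k)).
  by move=> kn; left; exists k; [exact: ltnW|rewrite S_sepE].
apply: (switch_trans lt_i1n (y := alpha z)).
  apply: (inrel _ (Sin i (ltnW lt_i1n))) => j; rewrite zE.
  exact: (switch_factor lt_i1n (sxy j)).1.
apply: (inrel _ (Sin i.+1 lt_i1n)) => j; rewrite zE.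
exact: (switch_factor lt_i1n (sxy j)).2.
Qed.

Lemma switch_closed_dual (A : algebra (J_signature n)) :
  switch_closed (fun (a : A) (x : dual E A) => val x a).
Proof.
move=> i x y lt_i1n xy.
have hz : @hom _ A (J_algebra n) (fun a => switch i (val x a) (val y a)).
  move=> f a; rewrite (set_valP x) (set_valP y) /=.
  by apply: (switch_op lt_i1n) => k; exact: xy.
by exists (SigSub (mem_set hz)).
Qed.

Lemma ISP_separated (Sg : signature) (M A : algebra Sg) (a b : A) : ISP M A ->
  (forall h : A -> M, hom h -> h a = h b) -> a = b.
Proof.
move=> [I [B [hB [h [hh [g hK _]]]]]] ab; apply: (can_inj hK).
apply/val_inj/funext => i; apply: (ab (fun a => val (h a) i)) => f x.
by rewrite hh.
Qed.

Lemma bijective_of (X Y : Type) (f : X -> Y) :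
  injective f -> (forall y, exists x, f x = y) -> bijective f.
Proof.
move=> finj /choice[g gK]; exists g => // x; exact/finj/gK.
Qed.

(** Homomorphisms separate the elements of [A], and interpolation gives surjectivity. Allowing any
    [E] whose relations include [rels n] covers the enlarged alter egos too. *)
Lemma duality : yields_duality E.
Proof.
move=> A ispA; split.
  by move=> f x; apply/val_inj/funext => u /=; rewrite (set_valP u).
apply: bijective_of => [a b ab|alpha].
  apply: (ISP_separated ispA) => h hh.
  by have := congr1 (fun e => val e (SigSub (mem_set hh) : dual E A)) ab.
have malpha := set_valP alpha.
have cdual := coordinates_dual E A.
have [||||a aE] := @interpolation n (dual E A) A (fun x => val x) (val alpha)
    (coord_compact cdual).
- by move=> x; exact: (set_valP x).
- by move=> a; have [] := coord_morphism cdual a.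
- by have [] := malpha.
- exact: (morphism_basic cdual (@switch_closed_dual A) malpha).
by exists a; apply/val_inj/funext.
Qed.

End Duality.

(** * Strong duality *)

Section Points.
Variables (n : nat) (X : topologicalType) (A : algebra (J_signature n)).
Variables (ev : X -> A -> J n) (u : A -> J n).
Hypothesis cX : compact [set: X].
Hypothesis ev_hom : forall x, @hom _ A (J_algebra n) (ev x).
Hypothesis ev_cont :
  forall a, continuous (fun x => ev x a : ego_space (J_algebra n)).
Hypothesis ev_inj : forall a b, (forall x, ev x a = ev x b) -> a = b.
Hypothesis u_hom : @hom _ A (J_algebra n) u.

(* If no point worked, then compactness would give d and e with e <= d at every
   point of X although u d = c0 < c1 = u e. *)
Lemma two_valued_point (T : A -> A) (g : J n -> J n) (c0 c1 : J n) :
  (forall h, @hom _ A (J_algebra n) h -> forall a, h (T a) = g (h a)) ->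
  (forall p, g p = c0 \/ g p = c1) -> c0 <> c1 -> tle c0 c1 ->
  exists x, forall a, g (u a) = g (ev x a).
Proof.
move=> Tg g01 c01 le01; apply: contrapT => nx.
have [_ _ trans] := tle_partial_order n.
have tjoinE p q : tle q p -> @tjoin n p q = p.
  move=> qp; apply: tle_anti; last exact: (tjoin_gel _ _).
  by rewrite tjoinP tle_refl.
have tmeetpp p : @tmeet n p p = p.
  apply: tle_anti; first exact: (tmeet_lel _ _).
  by rewrite tmeetP tle_refl.
suff [d [e [ud ue le]]] : exists d e, [/\ u d = c0, u e = c1 &
    forall x, setT x -> tle (ev x e) (ev x d)].
  apply: c01; rewrite -ud -ue; apply: tle_anti; first by rewrite ud ue.
  have {1}-> : d = bin_term (Tjoin n) d e.
    by apply: ev_inj => x; rewrite hom_tjoin // tjoinE // le.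
  by rewrite hom_tjoin //; exact: (tjoin_ger _ _).
apply: (compact_cover_ind (Q := fun V => exists d e,
  [/\ u d = c0, u e = c1 & forall x, V x -> tle (ev x e) (ev x d)])) => //.
- by exists (const_term A c0), (const_term A c1); split=> //; rewrite hom_const.
- by move=> U V UV [d [e [ud ue le]]]; exists d, e; split=> // x /UV/le.
- move=> U V [d [e [ud ue le]]] [d' [e' [ud' ue' le']]].
  exists (bin_term (Tjoin n) d d'), (bin_term (Tmeet n) e e'); split.
  + by rewrite hom_tjoin // ud ud' tjoinE // tle_refl.
  + by rewrite hom_tmeet // ue ue'.
  + move=> x; rewrite hom_tmeet // hom_tjoin // => -[/le|/le'] lex.
      exact: trans (tmeet_lel _ _) (trans _ _ _ lex (tjoin_gel _ _)).
    exact: trans (tmeet_ler _ _) (trans _ _ _ lex (tjoin_ger _ _)).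
move=> x; have [a na] : exists a, g (u a) <> g (ev x a).
  apply: contrapT => /forallNP na; apply: nx; exists x => a.
  exact: contrapT (na a).
exists [set y | ev y a = ev x a]; first exact: (ego_space_near x (@ev_cont a)).
(* As [g] has two values, [u] and [x] take opposite ones at [a]; [T a] plays one of [d], [e] and a
   constant the other. *)
have [ua|ua] := g01 (u a).
  have {na}xa : g (ev x a) = c1 by case: (g01 (ev x a)) na => -> //; rewrite ua.
  exists (T a), (const_term A c1); split; rewrite ?hom_const ?Tg // => y ya.
  by rewrite hom_const // Tg // ya xa tle_refl.
have {na}xa : g (ev x a) = c0 by case: (g01 (ev x a)) na => -> //; rewrite ua.
exists (const_term A c0), (T a); split; rewrite ?hom_const ?Tg // => y ya.
by rewrite hom_const // Tg // ya xa tle_refl.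
Qed.

(** For [k < n], [J_rel (threshold k)] is the intersection of S_{n,k} with its converse. *)
Definition threshold (k : nat) : rel nat := fun a b => (a <= k)%N == (b <= k)%N.

Lemma threshold_point (k : nat) : (k < n)%N ->
  exists x, forall a, @J_rel n (threshold k) (u a, ev x a).
Proof.
move=> kn.
have kE : nat_of_ord (inord k : 'I_n.+1) = k by rewrite inordK; lia.
have k1E : nat_of_ord (inord k.+1 : 'I_n.+1) = k.+1 by rewrite inordK; lia.
pose c0 : J n := f_ (inord k); pose c1 : J n := f_ (inord k.+1).
(* [g] clamps to the truth interval from f_k to f_{k+1}; it equals f_k exactly on f_0, ..., f_k. *)
pose g p := tjoin (tmeet p c1) c0.
pose T a := bin_term (Tjoin n) (bin_term (Tmeet n) a (const_term A c1))
  (const_term A c0).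
(* [g'] is f_k on [Top] and F_n, and f_{k+1} on [Bot] and T_n. With its value at the negation it
   tells these four blocks apart, and being [g] after a term it needs no second point. *)
pose g' p := g (kmeet (kjoin (tmeet (tjoin p Top) Bot) (t_ ord0)) c0).
pose T' a := bin_term (Kmeet n) (bin_term (Kjoin n) (bin_term (Tmeet n)
  (bin_term (Tjoin n) a (const_term A Top)) (const_term A Bot))
  (const_term A (t_ ord0))) (const_term A c0).
have Tg h : @hom _ A (J_algebra n) h -> forall a, h (T a) = g (h a).
  by move=> hh a; rewrite hom_tjoin // hom_tmeet // !hom_const.
have T'g h : @hom _ A (J_algebra n) h -> forall a, g (h (T' a)) = g' (h a).
  move=> hh a; rewrite hom_kmeet // hom_kjoin // hom_tmeet // hom_tjoin //.
  by rewrite !hom_const.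
have c1m : tjoin c1 c0 = c1 by rewrite tjoinC_f // kE k1E.
have g_f a : g (f_ a) = if (a <= k)%N then c0 else c1.
  rewrite /g; case: leqP => ak.
    by rewrite tmeet_f ?tjoin_f // ?kE ?k1E //; lia.
  by rewrite tmeetC_f ?c1m // k1E.
have g_else p : (forall a, p <> f_ a) -> g p = c1.
  by move=> np; rewrite /g; case: p np => [||a|a] // /(_ a).
have c01 : c0 <> c1 by move=> [/(congr1 (@nat_of_ord _))]; rewrite kE k1E; lia.
have [|||x xE] := two_valued_point (T := T) (g := g) (c0 := c0) (c1 := c1) Tg.
- case=> [||a|a]; rewrite ?g_f ?g_else //; [right|right| |right] => //.
  by case: ifP; [left|right].
- exact: c01.
- by rewrite /= kE k1E.
have g'E p : g' p = match p with Top | f_ _ => c0 | _ => c1 end.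
  have gc0 : g c0 = c0 by rewrite g_f kE leqnn.
  by case: p => [||a|a]; first [exact: gc0 | exact: (g_else Bot)].
have xE' a : g' (u a) = g' (ev x a) by rewrite -!T'g.
exists x => a; move: (xE a) (xE (neg_term a)) (xE' a) (xE' (neg_term a)).
rewrite !hom_neg // !g'E; case: (u a) (ev x a) => [||p|p] [||q|q] //=;
  rewrite /threshold ?g_f ?g_else //.
all: do 2?case: ifP => //=; move=> *; case: c01; congruence.
Qed.


(** For [n = 0] there is no threshold, but F_0 and T_0 are singletons, so a term separating the four
    blocks suffices. For [n = 1] the only threshold separates the two levels. *)
Lemma point_of_hom : (n <= 1)%N -> exists x, forall a, u a = ev x a.
Proof.
case: (posnP n) => [n0 _|n_gt0 n_le1].
  pose g (p : J n) := tmeet (tjoin p Top) Bot.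
  pose T a := bin_term (Tmeet n) (bin_term (Tjoin n) a (const_term A Top))
    (const_term A Bot).
  have Tg h : @hom _ A (J_algebra n) h -> forall a, h (T a) = g (h a).
    by move=> hh a; rewrite hom_tmeet // hom_tjoin // !hom_const.
  have [|||x xE] :=
      two_valued_point (T := T) (g := g) (c0 := f_ ord_max) (c1 := Bot) Tg => //.
    by case=> [||a|a]; rewrite /g /=; [left|right|left|right].
  exists x => a; move: (xE a) (xE (neg_term a)).
  have ord_eq (i j : 'I_n.+1) : i = j.
    by apply: val_inj => /=; have := ltn_ord i; have := ltn_ord j; lia.
  rewrite !hom_neg //; case: (u a) (ev x a) => [||i|i] [||j|j] //= _ _.
    by rewrite (ord_eq i j).
  by rewrite (ord_eq i j).
have [x xE] := threshold_point n_gt0; exists x => a.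
have ord_eq (i j : 'I_n.+1) : threshold 0 i j -> i = j.
  move=> ij; apply: val_inj => /=; have := ltn_ord i; have := ltn_ord j.
  by move: ij; rewrite /threshold; lia.
by move: (xE a); case: (u a) (ev x a) => [||i|i] [||j|j] //= /ord_eq->.
Qed.

(** The value is read off an arbitrary preimage [a]; independence of that choice is shown for the
    points chosen in [pop_of_hom]. *)
Definition determined_pop (x : 'I_n -> X) : partial_operation (J n) :=
  @PartialOperation (J n) n (fun v =>
    if pselect (exists a, forall k, v k = ev (x k) a) is left va
    then Some (u (projT1 (cid va))) else None).

(* The thresholds k < n separate the points of J_n, so u factors through the n
   points found one threshold at a time. *)
Lemma pop_of_hom : (0 < n)%N -> exists (x : 'I_n -> X),
  @compatible_pop _ (J_algebra n) (determined_pop x) /\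
  forall a, determined_pop x (fun k => ev (x k) a) = Some (u a).
Proof.
move=> n_gt0.
have /choice[x xE] : forall k : 'I_n,
    exists x, forall a, @J_rel n (threshold k) (u a, ev x a).
  by move=> k; exact: threshold_point.
have ord_eq (i j : 'I_n.+1) : (forall k : 'I_n, threshold k i j) -> i = j.
  move=> ij; apply/val_inj/eqP; rewrite eqn_leq /=; apply/andP; split.
    case: (leqP i j) => // ji.
    have jn : (j < n)%N by have := ltn_ord i; lia.
    by have := ij (Ordinal jn); rewrite /threshold /=; lia.
  case: (leqP j i) => // lt_ij.
  have lt_in : (i < n)%N by have := ltn_ord j; lia.
  by have := ij (Ordinal lt_in); rewrite /threshold /=; lia.
have uE a b : (forall k, ev (x k) a = ev (x k) b) -> u a = u b.
  move=> ab.
  have {ab}: forall k : 'I_n, @J_rel n (threshold k) (u a, u b).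
    move=> k; move: (xE k a) (xE k b); rewrite ab.
    case: (u a) (ev (x k) b) (u b) => [||i|i] [||j|j] [||l|l] //=;
      by rewrite /threshold => /eqP-> /eqP->.
  have k0 : 'I_n by exact: Ordinal n_gt0.
  case: (u a) (u b) => [||i|i] [||j|j] // ij; try by have := ij k0.
    by rewrite (ord_eq i j).
  by rewrite (ord_eq i j).
have popE a : determined_pop x (fun k => ev (x k) a) = Some (u a).
  rewrite /determined_pop /=; case: pselect => [va|[]]; last by exists a.
  by congr Some; apply: uE => k; case: cid => b /= ->.
exists x; split=> //; split.
  exists (fun k => if unlift ord_max k is Some l then ev (x l) (const_term A Top)
    else u (const_term A Top)).
  rewrite /graph /= unlift_none -popE; congr (determined_pop x _).
  by apply: funext => k /=; rewrite liftK.
move=> f v vg.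
(* The graph is the image of [A] under the homomorphisms [ev (x l)] and [u], hence closed under the
   operations. *)
have /choice[a aE] : forall k, exists a,
    (forall l, v k (lift ord_max l) = ev (x l) a) /\ v k ord_max = u a.
  move=> k; move: (vg k); rewrite /graph /determined_pop /=.
  case: pselect => // va [<-]; case: cid => b /= bE; by exists b.
have opE : (op (a := alg_power (J_algebra n) 'I_n.+1) v) \o lift ord_max =
    fun l => ev (x l) (op a).
  apply: funext => l; rewrite /= ev_hom; congr J_op; apply: funext => k /=.
  by rewrite (aE k).1.
change (determined_pop x (op (a := alg_power (J_algebra n) 'I_n.+1) v
  \o lift ord_max) = Some (op (a := alg_power (J_algebra n) 'I_n.+1) v ord_max)).
rewrite opE popE u_hom; congr (Some (J_op _)); apply: funext => k /=.
by rewrite (aE k).2.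
Qed.

End Points.

Section Strong.
Variables (n : nat) (E : alter_ego (J_algebra n)).
Hypothesis ego_relsE : forall r, rels n r -> ego_rels E (binary_relation r).
Hypothesis ego_popsE : (2 <= n)%N ->
  forall h : partial_operation (J n), pop_arity h = n ->
    @compatible_pop _ (J_algebra n) h -> ego_pops E h.

Lemma switch_closed_coordinates (X : structure E) (I : Type)
    (rho : I -> X -> J n) : coordinates rho -> switch_closed rho.
Proof.
move=> crho i x y lt_i1n xy.
have n_ge2 : (2 <= n)%N by lia.
have hE : ego_pops E (switch_pop lt_i1n).
  by apply: ego_popsE => //; exact: switch_pop_compatible.
have [|z _ zE] := coord_pop crho (h := SigSub (mem_set hE))
    (x := fun k : 'I_n => if nat_of_ord k == 0 then x else y)
    (y := fun j => switch i (rho j x) (rho j y)); last by exists z.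
move=> j; rewrite -(switch_pop_val lt_i1n (xy j)).
by apply: (congr1 (switch_pop lt_i1n)); apply: funext => k /=; case: ifP.
Qed.

Lemma hom_of_point (X : structure E) (I : Type) (rho : I -> X -> J n)
    (u : predual X -> J n) : coordinates rho ->
  @hom _ (predual X) (J_algebra n) u ->
  exists x, forall a : predual X, u a = val a x.
Proof.
move=> crho hu.
have cX := coord_compact crho.
pose ev (x : X) (a : predual X) : J n := val a x.
have ev_hom x : @hom _ (predual X) (J_algebra n) (ev x) by [].
have ev_cont a : continuous (fun x => ev x a : ego_space (J_algebra n)).
  by have [] := set_valP a.
have ev_inj a b : (forall x, ev x a = ev x b) -> a = b.
  by move=> ab; apply/val_inj/funext.
case: (leqP n 1) => [n_le1|n_ge2].
  exact: (point_of_hom cX ev_hom ev_cont ev_inj hu n_le1).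
have [x [xc xE]] := pop_of_hom cX ev_hom ev_cont ev_inj hu (ltnW n_ge2).
have hE : ego_pops E (determined_pop ev u x) by exact: ego_popsE.
pose rhoE i : predual X := SigSub (mem_set (coord_morphism crho i)).
have [i|z xz zE] := coord_pop crho (h := SigSub (mem_set hE)) (x := x)
    (y := fun i => u (rhoE i)); first exact: (xE (rhoE i)).
(* The morphism [a] preserves the partial operation, so its value at [z] is the one taken at the
   tuple [ev (x k) a], namely [u a]. *)
exists z => a; have [_ _ /(_ _ _ _ xz) + _] := set_valP a.
by have := xE a; rewrite /ev /= => -> [].
Qed.

Lemma strong_duality : yields_strong_duality E.
Proof.
split; [split; first exact: duality|].
  move=> X /coordinates_IScP[I [rho crho]].
  by apply: (eval_str_isomorphism crho) => u hu; exact: hom_of_point crho hu.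
move=> X Y phi alpha _ /coordinates_IScP[I [rho crhoY]] emb malpha.
have crho := coordinates_embedding emb crhoY.
(* Elements of [predual Y] are evaluated along [phi]; they include the coordinates of [Y], which
   restrict to coordinates of [X]. *)
have [|||s bs x y sxy|b bE] := @interpolation n X (predual Y)
    (fun x b => val b (phi x)) alpha (coord_compact crho).
- by [].
- move=> b; have [+ _ _ _] := set_valP b => cb x.
  have [S [hS [psi [_ [[cpsi _ _ _] _] phiE]]]] := emb.
  have -> : (fun x => val b (phi x)) = val b \o phi by [].
  apply: continuous_comp; last exact: cb.
  have -> : phi = val \o psi by apply: funext => z; exact: phiE.
  apply: continuous_comp; first exact: cpsi.
  exact: (@initial_continuous (substructure hS) Y val).
- by have [] := malpha.
- apply: (morphism_basic ego_relsE crho (switch_closed_coordinates crho) malpha bs).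
  by move=> i; exact: (sxy (SigSub (mem_set (coord_morphism crhoY i)))).
by exists (val b); split; [exact: set_valP|exact: funext].
Qed.

End Strong.

(** * Optimality *)

Section Optimality.
Variable n : nat.

Lemma rels_cases (r : set (J n * J n)) : rels n r ->
  r = S_eq n \/ exists i j, [/\ (i <= j < n)%N, j != i.+1 & r = @J_rel n (sep i j)].
Proof.
case=> [[i /= i_le_n <-]|[i [j [ltin ltjn ltij ->]]]].
  case: (ltnP i n) => [lt_in|n_le_i]; last by left; rewrite /S_ ltnNge n_le_i.
  by right; exists i, i; rewrite leqnn lt_in S_sepE //; split=> //; lia.
by right; exists i, j; rewrite R_sepE; [split=> //; lia|lia].
Qed.


Section TestAlgebra.
Variables (r : set (J n * J n)) (nr : rels n r).

Lemma rels_subuniverse :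
  @subuniverse _ (alg_power (J_algebra n) 'I_2) (rel_val (binary_relation r)).
Proof. by have [] : compatible_rel _ := J_ego_relsP (imageP _ nr). Qed.

Definition test_algebra : algebra (J_signature n) := subalgebra rels_subuniverse.

Definition fst_hom (a : test_algebra) : J n := val a ord0.
Definition snd_hom (a : test_algebra) : J n := val a ord_max.

Lemma fst_homP : @hom _ test_algebra (J_algebra n) fst_hom.
Proof. by []. Qed.

Lemma snd_homP : @hom _ test_algebra (J_algebra n) snd_hom.
Proof. by []. Qed.

Lemma test_algebra_ext (a b : test_algebra) :
  fst_hom a = fst_hom b -> snd_hom a = snd_hom b -> a = b.
Proof.
move=> ab1 ab2; apply/val_inj/funext => k.
by case: (unliftP ord_max k) => [l|] -> //; rewrite (_ : lift _ l = ord0) //;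
  apply: val_inj; rewrite /= ord1.
Qed.

Lemma test_algebra_rel (a : test_algebra) : r (fst_hom a, snd_hom a).
Proof. exact: set_valP a. Qed.

Lemma test_algebra_point (x y : J n) : r (x, y) ->
  exists a, fst_hom a = x /\ snd_hom a = y.
Proof.
move=> rxy; have B : rel_val (binary_relation r) (pair_fun x y) by [].
by exists (SigSub (mem_set B)).
Qed.

(* The morphism that is not an evaluation is g composed with the evaluation at
   c: the homomorphisms fst and snd are related by r, but their images under it
   are not. *)
Lemma not_duality_remove (c : test_algebra) (g : J n -> J n) :
  ~ r (g (fst_hom c), g (snd_hom c)) ->
  (forall z z' : test_algebra -> J n,
    @hom _ test_algebra (J_algebra n) z ->
    @hom _ test_algebra (J_algebra n) z' ->
    forall s, rels n s -> s <> r -> (forall a, s (z a, z' a)) ->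
    s (g (z c), g (z' c))) ->
  ~ yields_duality (remove_rel (J_ego n) (binary_relation r)).
Proof.
move=> ngc gP dual_r.
have ispA : ISP (J_algebra n) test_algebra.
  exists 'I_2, _, rels_subuniverse, id; split=> //.
  by exists id.
set E := remove_rel _ _ in dual_r.
have malpha : morphism (X := dual E test_algebra) (Y := ego_structure E)
    (fun z => g (val z c)).
  have [ce _ _ _] := eval_morphism E c.
  split.
  - move=> z; apply: (@continuous_comp (dual E test_algebra)
      (ego_space (J_algebra n)) (ego_space (J_algebra n))
      (fun z => val z c) g); first exact: ce.
    move=> U; rewrite !nbhs_principalE => /principal_filterP gU.
    exact/principal_filterP.
  - by case=> f hf; have := set_mem hf.
  - by case=> h hh; have := set_mem hh.
  - case=> s hs z; have := set_mem hs => -[[s' ns' sE] ns].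
    move: hs z; rewrite -sE => hs z sz.
    apply: (gP (val (z ord0)) (val (z ord_max))) => //.
    + exact: (set_valP (z ord0)).
    + exact: (set_valP (z ord_max)).
    + by move=> s'r; apply: ns; rewrite /= -sE s'r.
have [_ [h _ hK]] := dual_r _ ispA.
pose alpha : predual (dual E test_algebra) := SigSub (mem_set malpha).
have alphaE (z : dual E test_algebra) : val z (h alpha) = g (val z c).
  have := congr1 (fun e : predual (dual E test_algebra) => val e z) (hK alpha).
  by [].
apply: ngc.
have := alphaE (SigSub (mem_set fst_homP)).
have := alphaE (SigSub (mem_set snd_homP)).
by move=> /= <- <-; exact: test_algebra_rel.
Qed.

End TestAlgebra.

(** Since [c] is its own negation, [z c] and [z' c] lie in [{Top, Bot}], and each remaining relation
    forces them to be equal. *)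
Lemma not_duality_remove_S_eq :
  ~ yields_duality (remove_rel (J_ego n) (binary_relation (S_eq n))).
Proof.
have nS : rels n (S_eq n) by left; exists n => //=; rewrite /S_ ltnn.
have [|c [c1 c2]] := test_algebra_point nS (x := Bot) (y := Top).
  by rewrite S_eqE.
apply: (@not_duality_remove _ nS c (fun x => if x is Bot then Top else Bot)).
  by rewrite c1 c2 S_eqE.
move=> z z' hz hz' s /rels_cases[//|[i [j [_ _ ->]]]] _ /(_ c).
have negc : neg_term c = c.
  by apply: test_algebra_ext; rewrite hom_neg ?c1 ?c2.
have := hom_neg hz c; have := hom_neg hz' c; rewrite negc.
by case: (z c) (z' c) => [||a|a] [||b|b].
Qed.

Section Chain.
Variables i j : nat.
Hypotheses (ij : (i <= j < n)%N) (ij1 : j != i.+1).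

Lemma sep_rels : rels n (@J_rel n (sep i j)).
Proof.
have [->|ne] := eqVneq i j.
  by left; exists j; [rewrite /=; lia|rewrite S_sepE //; lia].
right; exists i, j; split; try lia.
by rewrite R_sepE //; lia.
Qed.

Local Notation A := (test_algebra sep_rels).
Local Notation p1 := (@fst_hom _ sep_rels).
Local Notation p2 := (@snd_hom _ sep_rels).

Lemma sep_hom_tmeet (z : A -> J n) (a b d e : A) :
  @hom _ A (J_algebra n) z ->
  tmeet (p1 a) (p1 b) = tmeet (p1 d) (p1 e) ->
  tmeet (p2 a) (p2 b) = tmeet (p2 d) (p2 e) ->
  tmeet (z a) (z b) = tmeet (z d) (z e).
Proof.
move=> hz e1 e2; rewrite -!(hom_tmeet hz); congr z.
by apply: test_algebra_ext; rewrite !hom_tmeet //.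
Qed.

Lemma sep_hom_tjoin (z : A -> J n) (a b d e : A) :
  @hom _ A (J_algebra n) z ->
  tjoin (p1 a) (p1 b) = tjoin (p1 d) (p1 e) ->
  tjoin (p2 a) (p2 b) = tjoin (p2 d) (p2 e) ->
  tjoin (z a) (z b) = tjoin (z d) (z e).
Proof.
move=> hz e1 e2; rewrite -!(hom_tjoin hz); congr z.
by apply: test_algebra_ext; rewrite !hom_tjoin //.
Qed.

(** The elements of F_n are those below f_n in the truth order, a condition expressed by an equation
    that [z] preserves. *)
Lemma sep_hom_f (z : A -> J n) (a : A) (x y : 'I_n.+1) :
  @hom _ A (J_algebra n) z -> p1 a = f_ x -> p2 a = f_ y ->
  exists m, z a = f_ m.
Proof.
move=> hz a1 a2; have := @sep_hom_tmeet z a (const_term A (f_ ord_max)) a a hz.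
rewrite !hom_const // a1 a2 !tmeet_f ?leq_ord // => /(_ erefl erefl).
by case: (z a) => [||m|m] //= _; eexists.
Qed.

Section Levels.
Variables (z : A -> J n) (a b : A) (x y x' y' s t v : 'I_n.+1).
Hypothesis hz : @hom _ A (J_algebra n) z.
Hypotheses (a1 : p1 a = f_ x) (a2 : p2 a = f_ y) (za : z a = f_ s).
Hypotheses (b1 : p1 b = f_ x') (b2 : p2 b = f_ y') (zb : z b = f_ t).

Lemma sep_hom_minn : minn x x' = minn x v -> minn y y' = minn y v ->
  minn s t = minn s v.
Proof.
move=> ex ey; have := @sep_hom_tmeet z a b a (const_term A (f_ v)) hz.
have ox : Order.min x x' = Order.min x v by apply: val_inj; rewrite /= !val_omin.
have oy : Order.min y y' = Order.min y v by apply: val_inj; rewrite /= !val_omin.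
rewrite !hom_const // a1 a2 b1 b2 za zb /= ox oy => /(_ erefl erefl).
by case=> /(congr1 (@nat_of_ord _)); rewrite !val_omin.
Qed.

Lemma sep_hom_maxn : maxn x x' = maxn x v -> maxn y y' = maxn y v ->
  maxn s t = maxn s v.
Proof.
move=> ex ey; have := @sep_hom_tjoin z a b a (const_term A (f_ v)) hz.
have ox : Order.max x x' = Order.max x v by apply: val_inj; rewrite /= !val_omax.
have oy : Order.max y y' = Order.max y v by apply: val_inj; rewrite /= !val_omax.
rewrite !hom_const // a1 a2 b1 b2 za zb /= ox oy => /(_ erefl erefl).
by case=> /(congr1 (@nat_of_ord _)); rewrite !val_omax.
Qed.

End Levels.

Lemma sep_point (a b : 'I_n.+1) : sep i j a b ->
  exists w : A, p1 w = f_ a /\ p2 w = f_ b.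
Proof. by move=> ab; exact: (test_algebra_point sep_rels). Qed.

(* z is determined by m, where z c = f_m; if i + 1 < j the values at (f_0, f_j)
   and (f_{i+1}, f_n) leave only m = n and m = 0. *)
Lemma sep_hom_dichotomy (z : A -> J n) (c : A) : (i.+1 < j)%N ->
  @hom _ A (J_algebra n) z -> p1 c = f_ ord_max -> p2 c = f_ ord0 ->
  (z c = f_ ord_max /\
   forall a x y, p1 a = f_ x -> p2 a = f_ y -> z a = f_ x) \/
  (z c = f_ ord0 /\
   forall a x y, p1 a = f_ x -> p2 a = f_ y -> z a = f_ y).
Proof.
move=> i1j hz c1 c2.
have [m zc] := sep_hom_f hz c1 c2.
have [ltjn1 lti1n1] : (j < n.+1 /\ i.+1 < n.+1)%N by lia.
pose oj : 'I_n.+1 := Ordinal ltjn1; pose oi : 'I_n.+1 := Ordinal lti1n1.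
have [|e [e1 e2]] := @sep_point ord0 oj; first by rewrite /sep /=; lia.
have [|h [h1 h2]] := @sep_point oi ord_max; first by rewrite /sep /=; lia.
have [p ze] := sep_hom_f hz e1 e2; have [q zh] := sep_hom_f hz h1 h2.
have eq1 : minn m p = minn m (ord0 : 'I_n.+1).
  by apply: (sep_hom_minn hz c1 c2 zc e1 e2 ze) => /=; lia.
have eq2 : maxn m q = maxn m (ord_max : 'I_n.+1).
  by apply: (sep_hom_maxn hz c1 c2 zc h1 h2 zh) => /=; lia.
have eq3 : maxn m p = maxn m oj.
  by apply: (sep_hom_maxn hz c1 c2 zc e1 e2 ze) => /=; lia.
have eq4 : minn m q = minn m oi.
  by apply: (sep_hom_minn hz c1 c2 zc h1 h2 zh) => /=; lia.
have [lem lep leq] := And3 (leq_ord m) (leq_ord p) (leq_ord q).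
(* For [0 < m < n], [eq1] and [eq2] give [p = 0] and [q = n]; then [eq3] and [eq4] give
   [j <= m <= i.+1]. *)
have [m_n|m_0] : nat_of_ord m = n \/ nat_of_ord m = 0.
  by move: eq1 eq2 eq3 eq4 => /=; lia.
- have mE : m = ord_max by apply: val_inj.
  left; split=> [|a x y a1 a2]; first by rewrite zc mE.
  have [s zs] := sep_hom_f hz a1 a2; rewrite zs; congr f_; apply: val_inj.
  have /= := sep_hom_minn (v := x) hz c1 c2 zc a1 a2 zs.
  have := leq_ord s; have := leq_ord x; have := leq_ord y; lia.
- have mE : m = ord0 by apply: val_inj.
  right; split=> [|a x y a1 a2]; first by rewrite zc mE.
  have [s zs] := sep_hom_f hz a1 a2; rewrite zs; congr f_; apply: val_inj.
  have /= := sep_hom_maxn (v := y) hz c1 c2 zc a1 a2 zs.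
  have := leq_ord s; have := leq_ord y; have := leq_ord x; lia.
Qed.

Lemma not_duality_remove_sep :
  ~ yields_duality (remove_rel (J_ego n) (binary_relation (@J_rel n (sep i j)))).
Proof.
have [ltin1 ltj1n1] : (i < n.+1 /\ j.+1 < n.+1)%N by lia.
pose oi : 'I_n.+1 := Ordinal ltin1; pose oj : 'I_n.+1 := Ordinal ltj1n1.
have [|c [c1 c2]] := @sep_point ord_max ord0; first by rewrite /sep /=; lia.
(* The images of the coordinates of [c] form [(f_ oi, f_ oj)], the corner of the excluded rectangle,
   here with [oj] equal to [j.+1]. *)
pose g (x : J n) : J n := if x == f_ ord_max then f_ oi else f_ oj.
have ne0 : f_ ord0 != f_ ord_max :> J n.
  by apply/eqP => -[]; lia.
apply: (@not_duality_remove _ sep_rels c g).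
  by rewrite c1 c2 /g eqxx (negbTE ne0) /= /sep; lia.
move=> z z' hz hz' s /rels_cases[->|[k [l [kl kl1 ->]]]] ns szz'.
  by rewrite S_eqE /g /=; do 2!case: ifP.
have ne : (k != i) || (l != j).
  by apply: contra_notT ns; rewrite negb_or !negbK => /andP[/eqP-> /eqP->].
rewrite /g; case: eqP => zc; case: eqP => z'c; rewrite /= /sep /=; try lia.
(* Otherwise [i = j], and excluding [(i, i.+1)] from [sep k l] with [k <= l] forces [k = l = i]. *)
have [lt_i1j|] := ltnP i.+1 j; last by lia.
have [[_ zE]|[zc0 _]] := sep_hom_dichotomy lt_i1j hz c1 c2; last first.
  by rewrite zc0 in zc; rewrite zc eqxx in ne0.
have [[//]|[_ z'E]] := sep_hom_dichotomy lt_i1j hz' c1 c2.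
have sep_ab (a b : 'I_n.+1) : sep i j a b -> sep k l a b.
  move=> /sep_point[w [w1 w2]]; have := szz' w.
  by rewrite (zE _ _ _ w1 w2) (z'E _ _ _ w1 w2).
have [ltjn lti1n] : (j < n.+1 /\ i.+1 < n.+1)%N by lia.
(* These pairs force [j <= l] and [k <= i], so [sep k l] could exclude [(i, j.+1)] only if [k = i]
   and [l = j]. *)
have := sep_ab ord0 (Ordinal ltjn); have := sep_ab (Ordinal lti1n) ord_max.
by rewrite /sep /=; lia.
Qed.

End Chain.

Lemma optimal_duality : yields_optimal_duality (J_ego n).
Proof.
split=> //; first by apply: duality => r nr; exists r.
move=> _ [r /rels_cases[->|[i [j [ij ij1 ->]]]] <-].
  exact: not_duality_remove_S_eq.
exact: not_duality_remove_sep.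
Qed.

End Optimality.

(** * Number of relations *)

Section Counting.
Variable n : nat.

Definition rel_codes : {set option ('I_n * 'I_n)} :=
  None |: [set Some p | p : 'I_n * 'I_n in
    [set p : 'I_n * 'I_n | (p.2 <= p.1)%N && (p.1 != p.2.+1 :> nat)]]%SET.

(* The pair is (j, i). *)
Definition rel_decode (c : option ('I_n * 'I_n)) : set (J n * J n) :=
  if c is Some p then @J_rel n (sep p.2 p.1) else S_eq n.

(** [sep i' j'] excludes [(i, n)] exactly when [i <= i'], and [(0, j.+1)] exactly when [j' <= j]. *)
Lemma sep_inj (i j i' j' : nat) : (i <= j < n)%N -> (i' <= j' < n)%N ->
  @J_rel n (sep i j) = @J_rel n (sep i' j') -> i = i' /\ j = j'.
Proof.
move=> ij ij' eqs.
have E (a b : nat) : (a <= n)%N -> (b <= n)%N -> sep i j a b = sep i' j' a b.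
  move=> an bn; apply/idP/idP.
    move=> ab; have : @J_rel n (sep i j) (f_ (inord a), f_ (inord b)).
      by rewrite /= !inordK.
    by rewrite eqs /= !inordK.
  move=> ab; have : @J_rel n (sep i' j') (f_ (inord a), f_ (inord b)).
    by rewrite /= !inordK.
  by rewrite -eqs /= !inordK.
have [ltin ltjn] : (i <= n /\ j.+1 <= n)%N by lia.
have [ltin' ltjn'] : (i' <= n /\ j'.+1 <= n)%N by lia.
have := E i n ltin (leqnn n); have := E i' n ltin' (leqnn n).
have := E 0 j.+1 (leq0n n) ltjn; have := E 0 j'.+1 (leq0n n) ltjn'.
by rewrite /sep; lia.
Qed.

Lemma rel_decode_inj : {in rel_codes &, injective rel_decode}.
Proof.
have nS (p : 'I_n * 'I_n) : @J_rel n (sep p.2 p.1) <> S_eq n.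
  move=> /seteqP[_ /(_ (Bot, Top))]; by rewrite S_eqE => /(_ isT).
have codeP p : Some p \in rel_codes -> (p.2 <= p.1 < n)%N.
  by rewrite !inE /= => /imsetP[q + [->]]; rewrite inE => /andP[-> _] /=.
move=> [p|] [q|] //= pc qc; last 2 first.
- by move/nS.
- by move/esym/nS.
move=> /(sep_inj (codeP _ pc) (codeP _ qc))[e2 e1].
by congr Some; case: p q e1 e2 {pc qc} => [p1 p2] [q1 q2] /= /val_inj-> /val_inj->.
Qed.

Lemma relsE : rels n = [set rel_decode c | c in [set` rel_codes]].
Proof.
apply/seteqP; split=> [r /rels_cases[->|[i [j [ij ij1 ->]]]]|_ [c /= + <-]].
- by exists None => //=; rewrite !inE.
- have [ltin ltjn] : (i < n /\ j < n)%N by lia.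
  exists (Some (Ordinal ltjn, Ordinal ltin)) => //=.
  rewrite !inE /=; apply/imsetP; exists (Ordinal ltjn, Ordinal ltin) => //.
  by rewrite inE /= ij1; lia.
rewrite !inE => /orP[/eqP-> /=|/imsetP[p + ->]].
  by left; exists n => //=; rewrite /S_ ltnn.
by rewrite inE => /andP[p21 p1]; apply: sep_rels => //; rewrite p21 /=.
Qed.

(** Row [j] consists of the [i <= j] other than [j - 1]: these are [j] indices, except that row 0
    has one. The last summand counts [None]. *)
Lemma card_rel_codes : #|rel_codes| = 'C(n, 2) + (0 < n)%N + 1.
Proof.
rewrite /rel_codes cardsU1 (_ : None \notin _) /=; last first.
  by apply/imsetP => -[].
rewrite card_imset; last by move=> p q [].
rewrite addnC; congr (_ + 1); rewrite -sum1_card.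
under eq_bigl do rewrite inE.
rewrite -(pair_big_dep xpredT
  (fun j i : 'I_n => (i <= j)%N && (j != i.+1 :> nat)) (fun _ _ => 1)) /=.
have row (j : nat) : \sum_(i < j.+1 | j != i.+1) 1 = j + (j == 0).
  case: j => [|j]; first by rewrite big_mkcond big_ord1.
  rewrite big_mkcond !big_ord_recr /= eqxx [j.+1 == j.+2]ltn_eqF // addn0.
  rewrite (eq_bigr (fun=> 1)) => [|i _]; last by rewrite eqSS gtn_eqF.
  by rewrite sum1_card card_ord addn0 addn1.
transitivity (\sum_(j < n) (j + (nat_of_ord j == 0))).
  apply: eq_bigr => j _; rewrite -row.
  rewrite (big_ord_widen_cond n (fun i => j != i.+1 :> nat) (fun=> 1)) //.
  by apply: eq_bigl => i; rewrite ltnS andbC.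
rewrite big_split /= -bin2_sum big_mkord; congr (_ + _).
case: n => [|m]; first by rewrite big_ord0.
by rewrite big_ord_recl big1.
Qed.

Lemma card_rels : rels n #= `I_('C(n, 2) + (0 < n)%N + 1).
Proof.
rewrite relsE -card_rel_codes cardE.
set s := enum rel_codes.
have sP k : (k < size s)%N -> nth None s k \in rel_codes.
  by move=> ks; rewrite -mem_enum mem_nth.
have -> : [set rel_decode c | c in [set` rel_codes]] =
    [set rel_decode (nth None s k) | k in `I_(size s)].
  apply/seteqP; split=> [_ [c /= cc <-]|_ [k /= ks <-]].
    have cs : c \in s by rewrite mem_enum.
    by exists (index c s); rewrite /= ?index_mem ?nth_index.
  by exists (nth None s k) => //=; exact: sP.
apply: inj_card_eq => k l /set_mem /= ks /set_mem /= ls.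
move=> /(rel_decode_inj (sP _ ks) (sP _ ls))/eqP.
by rewrite nth_uniq ?enum_uniq // => /eqP.
Qed.

End Counting.

Theorem theorem4p1 :
  [/\ forall n : nat, yields_optimal_duality (J_ego n),
      yields_strong_duality (J_ego 0) /\ yields_strong_duality (J_ego 1),
      forall n : nat, (2 <= n)%N ->
        yields_strong_duality (add_pops (J_ego n) n) &
      rels 0 #= `I_1 /\
      forall n : nat, (1 <= n)%N -> rels n #= `I_((n ^ 2 - n + 4) %/ 2)].
Proof.
have rE n r : rels n r -> ego_rels (J_ego n) (binary_relation r).
  by move=> nr; exists r.
split; first exact: optimal_duality.
- by split; apply: strong_duality => //; exact: rE.
- move=> n _; apply: strong_duality => [|_ h hn hc]; first exact: rE.
  by right; split.
- split; first exact: card_rels 0.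
  move=> n n_gt0; have := card_rels n; rewrite n_gt0 bin2.
  have -> : (n ^ 2 - n = n * n.-1)%N by nia.
  suff -> : ((n * n.-1 + 4) %/ 2 = (n * n.-1)./2 + true + 1)%N by [].
  by move: (n * n.-1)%N => m; rewrite divn2; lia.
Qed.
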